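(* Assume (A1)--(A5) of the context. Let $(\delta_n)_n$ be a decreasing sequence of positive numbers with $\delta_n\to0$, let $(\bar\omega_t)_{t\in[0,T]}$ be a transition rule, and let $\eta^{\delta_n}\colon[0,T]\to X$ be the discrete quasistatic evolutions starting from $x_0\in X$ (with $|\partial E_0|(x_0)=0$). Suppose that there are a positive Radon measure $\bar\mu\in\mathcal M([0,T])$, $\bar{\mathcal E}\in BV([0,T],\mathbb R)$ and $\mathcal D\in L^\infty([0,T],\mathbb R)$ such that the convergences (C) of the context hold, and that Axioms 1, 2, 3 are satisfied. Then there is a curve $\hat\eta\colon[0,T]\to\mathcal X$ such that: (i) the right limit $\hat\eta^+(t)$ exists for every $t\in[0,T)$ and the left limit $\hat\eta^-(t)$ exists for every $t\in(0,T]$; (ii) for every $t\in[0,T]$, $\hat\eta(t)\subset\{(t,x)\in[0,T]\times X:|\partial E_t|(x)=0\}$; (iii) for every $0\le s\le t\le T$, $$\hat E\big(\hat\eta^+(t)\big)-\hat E\big(\hat\eta^-(s)\big)=\int_s^t\mathcal D(\tau)\,d\tau-\bar\mu([s,t]);$$ in particular the set $J$ of atoms of $\bar\mu$ is at most countable; (iv) $\hat\eta$ is continuous in $[0,T]\setminus J$, $J$ coincides with the jump set of $\hat\eta$, and for every $t\in[0,T]$ one has $\hat E(\hat\eta^-(t))-\hat E(\hat\eta^+(t))=\bar\mu(\{t\})$; (v) there is a subsequence $(\delta_{n_k})_k$ such that $q(t,\eta^{\delta_{n_k}}(t))\to\hat\eta(t)$ in $\mathcal X$ for all $t\in[0,T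]$.
   Context: Setting: $T>0$; $(X,d)$ is a metric space; $E\colon[0,T]\times X\to\mathbb R$, written $E_t(x)$. Slope: $|\partial E_t|(x)=\limsup_{x'\to x}\frac{(E_t(x)-E_t(x'))^+}{d(x,x')}$. $\mathrm{Crit}_t=\{x\in X:|\partial E_t|(x)=0\}$. (A1) $(X,d)$ is locally compact. (A2) $E$ is continuous; it is differentiable in $t$ with $\partial_tE$ continuous on $[0,T]\times X$; and $(t,x)\mapsto|\partial E_t|(x)$ is real-valued and continuous on $[0,T]\times X$. (A3) There are $C_1,C_2>0$ with $|\partial_tE_t(x)|\le C_1E_t(x)+C_2$ for all $(t,x)$. (A4) With $G(x)=\sup_{t\in[0,T]}|E_t(x)|$, the set $\{G\le C\}$ is compact for every $C\in\mathbb R$. (A5) For every $t$, $\mathrm{Crit}_t$ is a disjoint union of well-separated compact sets (each has positive distance from the union of the others), each of them path-connected by rectifiable paths; moreover $E_t$ is constant on every path-connected component of $\mathrm{Crit}_t$. Quotient space: $\mathcal X=([0,T]\times X)/\!\sim$ with the quotient topology, where $(t_1,x_1)\sim(t_2,x_2)$ iff they are equal, or $t_1=t_2$ and $x_1,x_2$ belong to the same path-connected component of $\mathrm{Crit}_{t_1}$; $q\colon[0,T]\times X\to\mathcal X$ is the quotient map, $[(t,x)]=q(t,x)$; elements of $\mathcal X$ are viewed as subsets of $[0,T]\times X$. By (A5), $\hat E([(t,x)]):=E_t(x)$ is well defined on $\mathcal X$. Transition rule: a family of maps $\bar\omega_t\colon X\to X$, $t\in[0,T]$. Discrete quasistatic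 evolution: given $\delta>0$ and $x_0$ with $|\partial E_0|(x_0)=0$, let $M=\lfloor T/\delta\rfloor$ (or $M=T/\delta-1$ if $T/\delta\in\mathbb Z$), $w_0=x_0$, $w_i=\bar\omega_{i\delta}(w_{i-1})$ for $i=1,\dots,M$; set $\eta^\delta(t)=w_i$ for $t\in[i\delta,(i+1)\delta)$, $i<M$, and $\eta^\delta(t)=w_M$ for $t\in[M\delta,T]$. Let $J^\delta=\{i\delta:1\le i\le M\}$, $\mathcal E_t(\eta^\delta)=E_t(\eta^\delta(t))$, $\mathcal E^\pm_t$ its right/left limits in time ($\mathcal E^-_0:=\mathcal E_0$, $\mathcal E^+_T:=\mathcal E_T$), and $\mu^\delta(B)=\sum_{t\in J^\delta\cap B}[\mathcal E^-_t(\eta^\delta)-\mathcal E^+_t(\eta^\delta)]$ for Borel $B\subset[0,T]$. (C) $\mu^{\delta_n}\rightharpoonup^*\bar\mu$ in $\mathcal M([0,T])$; $\mathcal E_t(\eta^{\delta_n})\to\bar{\mathcal E}_t$ for every $t\in[0,T]$; $\mathcal D^{\delta_n}\rightharpoonup^*\mathcal D$ in $L^\infty([0,T],\mathbb R)$, where $\mathcal D^{\delta_n}(t):=\partial_tE_t(\eta^{\delta_n}(t))$. Axiom 1: $E_t(\bar\omega_t(x))\le E_t(x)$ for all $x,t$. Axiom 2: $|\partial E_t|(\bar\omega_t(x))=0$ for all $x,t$. Axiom 3: whenever $\delta_n\downarrow0$ (positive, decreasing) and discrete quasistatic evolutions $\eta^{\delta_n}$ starting from $x_0$ satisfy convergences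 of the form (C), then for every $t\in[0,T]$, all sequences $t_1^n\le t_2^n$ in $[0,T]$ converging to $t$ and all $x_1,x_2\in X$ with $\eta^{\delta_n}(t_1^n)\to x_1$, $\eta^{\delta_n}(t_2^n)\to x_2$: if $x_1,x_2$ belong to different path-connected components of $\mathrm{Crit}_t$, then there is $c>0$ with $\bar\mu(\{t\})\ge c$ and $E_t(x_1)-E_t(x_2)\ge c$. Conventions: $\hat\eta^\pm(t)$ are the right/left limits of $\hat\eta$ in $\mathcal X$; at the endpoints $\hat\eta^-(0):=\hat\eta(0)$, $\hat\eta^+(T):=\hat\eta(T)$. *)

(* Defs.v *)
From HB Require Import structures.
From mathcomp Require Import all_boot all_order all_algebra.
From mathcomp Require Import all_classical all_reals all_analysis.
From mathcomp Require Import lra.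

Set Implicit Arguments.
Unset Strict Implicit.
Unset Printing Implicit Defensive.

Import Order.TTheory GRing.Theory Num.Theory.
Import numFieldNormedType.Exports.

Local Open Scope classical_set_scope.
Local Open Scope ring_scope.

Section paths.
Context {R : realType}.

(* [x] and [y] lie in the same path-connected component of [A]; the paths are
   parametrized by the unit interval, and their values outside of it are
   irrelevant. *)
Definition path_joined {X : topologicalType} (A : set X) (x y : X) : Prop :=
  exists g : R -> X,
    [/\ {within `[0, 1], continuous g}, g 0 = x, g 1 = y & g @` `[0, 1] `<=` A].

(* The sum of the d(g(s_i), g(s_{i+1})) along the partition [a :: s], as in
   [variation] (which is restricted to real-valued functions). *)
Definition path_variation {X : metricType R} (a b : R) (g : R -> X) (s : seq R)
  : R :=
  let G := g \o nth b (a :: s) in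
  \sum_(0 <= n < size s) mdist (G n) (G n.+1).

Definition rectifiable {X : metricType R} (g : R -> X) : Prop :=
  exists L : R, forall s, itv_partition 0 1 s -> path_variation 0 1 g s <= L.

Definition rectifiably_joined {X : metricType R} (A : set X) (x y : X) : Prop :=
  exists g : R -> X,
    [/\ {within `[0, 1], continuous g}, rectifiable g,
        g 0 = x, g 1 = y & g @` `[0, 1] `<=` A].

Lemma path_joined_refl {X : topologicalType} (A : set X) x :
  A x -> path_joined A x x.
Proof.
move=> Ax; exists (cst x); split=> //.
- by apply: continuous_subspaceT => z; exact: cvg_cst.
- by move=> _ [s _ <-].
Qed.

Lemma within_continuous_comp {X : topologicalType} (A B : set R)
    (u : R -> R) (g k : R -> X) :
  continuous u -> (forall s, A s -> B (u s)) -> (forall s, A s -> k s = g (u s)) ->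
  {within B, continuous g} -> {within A, continuous k}.
Proof.
move=> cu uAB kE /subspace_continuousP cg; apply/subspace_continuousP => s As.
move=> W; rewrite /from_subspace (kE _ As) => gW.
have hW : nbhs (u s) [set r | B r -> W (g r)] by exact: cg (uAB _ As) _ gW.
have hs : nbhs s [set r | B (u r) -> W (g (u r))] by exact: cu hW.
rewrite /within/=; apply: filterS hs => r /= h Ar.
by rewrite kE//; exact: h (uAB _ Ar).
Qed.

Lemma path_joined_sym {X : topologicalType} (A : set X) x y :
  path_joined A x y -> path_joined A y x.
Proof.
case=> g [cg g0 g1 gA].
have rev01 (s : R) : s \in `[0, 1] -> 1 - s \in `[0, 1].
  by rewrite !in_itv/= => /andP[s0 s1]; rewrite subr_ge0 s1 gerBl s0.
exists (fun s => g (1 - s)); split.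
- apply: within_continuous_comp (fun s => 1 - s) _ _ _ _ _ cg => //.
  by move=> s; apply: cvgB; [exact: cvg_cst|exact: cvg_id].
- by rewrite subr0.
- by rewrite subrr.
- by move=> _ [s s01 <-]; apply: gA; exists (1 - s) => //; exact: rev01.
Qed.

Lemma path_joined_trans {X : topologicalType} (A : set X) x y z :
  path_joined A x y -> path_joined A y z -> path_joined A x z.
Proof.
case=> g [cg g0 g1 gA] [h [ch h0 h1 hA]].
have h2 : (0 : R) <= 2^-1 by rewrite invr_ge0.
have h2' : (2^-1 : R) <= 1 by rewrite invf_le1// ler1n.
have l01 (s : R) : s \in `[0, 2^-1] -> 2 * s \in `[0, 1].
  by rewrite !in_itv/= => /andP[s0 s1]; apply/andP; split; lra.
have r01 (s : R) : s \in `[2^-1, 1] -> 2 * s - 1 \in `[0, 1].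
  by rewrite !in_itv/= => /andP[s0 s1]; apply/andP; split; lra.
pose k (s : R) := if s <= 2^-1 then g (2 * s) else h (2 * s - 1).
have kl s : s \in `[0, 2^-1] -> k s = g (2 * s).
  by rewrite in_itv/= /k => /andP[_ ->].
have kr s : s \in `[2^-1, 1] -> k s = h (2 * s - 1).
  rewrite in_itv/= /k => /andP[s2 _]; case: ifPn => // s2'.
  have -> : s = 2^-1 by apply/eqP; rewrite eq_le s2 s2'.
  by rewrite mulfV// subrr h0 g1.
have E01 : `[0, 1]%classic = `[0, 2^-1]%classic `|` `[2^-1, 1]%classic :> set R.
  apply/seteqP; split=> s /=; rewrite !in_itv/=.
    by move=> /andP[s0 s1]; case: (leP s 2^-1) => ss;
      [left; rewrite s0|right; rewrite s1 (ltW ss)].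
  case=> /andP[s0 s1]; first by rewrite s0 (le_trans s1).
  by rewrite s1 (le_trans h2).
exists k; split.
- rewrite E01; apply: withinU_continuous; [exact: itv_closed|exact: itv_closed| |].
  + apply: within_continuous_comp (fun s => 2 * s) _ _ _ l01 kl cg.
    by move=> s; apply: cvgM; [exact: cvg_cst|exact: cvg_id].
  + apply: within_continuous_comp (fun s => 2 * s - 1) _ _ _ r01 kr ch.
    move=> s; apply: cvgB; last exact: cvg_cst.
    by apply: cvgM; [exact: cvg_cst|exact: cvg_id].
- by rewrite /k h2 mulr0.
- rewrite kr; last by rewrite in_itv/= h2' lexx.
  by rewrite (_ : 2 * 1 - 1 = 1 :> R)//; lra.
- move=> _ [s s01 <-].
  have : (`[0, 1]%classic : set R) s by [].
  rewrite E01 => -[] /= ss.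
  + by rewrite kl//; apply: gA; exists (2 * s) => //; exact: l01.
  + by rewrite kr//; apply: hA; exists (2 * s - 1) => //; exact: r01.
Qed.

End paths.

Section energy.
Context {R : realType} {X : metricType R}.

(* The limsup of quantities in [0, +oo]: it is 0 at an isolated point, where
   [limf_esup] alone would give -oo. *)
Definition slope (f : X -> R) (x : X) : \bar R :=
  Order.max 0%E
    (limf_esup (fun y => (Num.max (f x - f y) 0 / mdist x y)%:E) x^').

(* A function on [0,T] x X is represented by [E : R -> X -> R], of which only
   the values at times in [0,T] are used. *)
Variables (T : R) (E : R -> X -> R).

Definition crit (t : R) : set X := [set x | slope (E t) x = 0%E].

Definition time_quotient (t : R) (x : X) (s : R) : R := (E s x - E t x) / (s - t).

(* one-sided at the endpoints of [0,T] *)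
Definition partial_t (t : R) (x : X) : R :=
  lim (time_quotient t x s @[s --> within `[0, T] t^']).

Definition energy_regular : Prop :=
  [/\ {within `[0, T] `*` setT, continuous (fun p : R * X => E p.1 p.2)},
      forall t x, t \in `[0, T] ->
        cvg (time_quotient t x s @[s --> within `[0, T] t^']),
      {within `[0, T] `*` setT,
         continuous (fun p : R * X => partial_t p.1 p.2)},
      forall t x, t \in `[0, T] -> slope (E t) x \is a fin_num &
      {within `[0, T] `*` setT,
         continuous (fun p : R * X => fine (slope (E p.1) p.2))}].

Definition power_control : Prop :=
  exists C1 C2 : R, [/\ 0 < C1, 0 < C2 &
    forall t x, t \in `[0, T] -> `|partial_t t x| <= C1 * E t x + C2].

Definition sup_energy (x : X) : \bar R :=
  ereal_sup [set `|E t x|%:E | t in `[0, T]].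

Definition compact_sublevels : Prop :=
  forall C : R, compact [set x | (sup_energy x <= C%:E)%E].

Definition well_separated (F : set (set X)) : Prop :=
  forall K, F K -> exists2 r : R, 0 < r &
    forall x y, K x -> (\bigcup_(L in F `\ K) L) y -> r <= mdist x y.

Definition critical_sets_split : Prop :=
  forall t, t \in `[0, T] ->
  (exists F : set (set X),
    [/\ crit t = \bigcup_(K in F) K, trivIset F id, well_separated F,
        forall K, F K -> compact K &
        forall K, F K -> forall x y, K x -> K y -> rectifiably_joined K x y]) /\
  (forall x y, path_joined (R := R) (crit t) x y -> E t x = E t y).

End energy.

Notation timeI T := (set_type (`[0, T]%classic)).

Section quotient.
Context {R : realType} (T : R) {X : metricType R} (E : R -> X -> R).

Definition sim (p q : timeI T * X) : bool :=
  `[< p = q \/ (p.1 = q.1 /\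
      path_joined (R := R) (crit E (set_val p.1)) p.2 q.2) >].

Lemma sim_refl : reflexive sim.
Proof. by move=> p; apply/asboolP; left. Qed.

Lemma sim_sym : symmetric sim.
Proof.
suff h p q : sim p q -> sim q p by move=> p q; apply/idP/idP; exact: h.
move=> /asboolP[->|[pq j]]; apply/asboolP; first by left.
by right; split=> //; rewrite -pq; exact: path_joined_sym.
Qed.

Lemma sim_trans : transitive sim.
Proof.
move=> q p r /asboolP[->//|[pq j]] /asboolP[<-|[qr k]]; apply/asboolP.
  by right.
right; split; first by rewrite pq.
by apply: path_joined_trans j _; rewrite pq.
Qed.

Definition sim_equiv := EquivRel sim sim_refl sim_sym sim_trans.

Definition qspace : Type := {eq_quot sim_equiv}%qT.

HB.instance Definition _ := Topological.copy qspace (quotient_topology qspace).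
HB.instance Definition _ := Quotient.on qspace.

Definition qmap (t : timeI T) (x : X) : qspace := (\pi_qspace (t, x))%qT.

Definition qclass (y : qspace) : set (timeI T * X) :=
  [set p | qmap p.1 p.2 = y].

(* Independent of the representative by [qenergy_qmap]. *)
Definition qenergy (y : qspace) : R :=
  E (set_val (repr y).1) (repr y).2.

Lemma qmapP t x s y : qmap t x = qmap s y <-> sim (t, x) (s, y).
Proof. by split=> [/eqmodP|h]; last exact/eqmodP. Qed.

Lemma qenergy_qmap t x : critical_sets_split T E ->
  qenergy (qmap t x) = E (set_val t) x.
Proof.
move=> hE; rewrite /qenergy.
have : sim (repr (qmap t x)) (t, x).
  case: (repr (qmap t x)) (reprK (qmap t x)) => s y /= h.
  by apply/qmapP; exact: h.
case: (repr _) => s y /asboolP[[-> ->]//|/= [<- j]].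
have /hE[_] : set_val s \in `[0, T] by have := set_valP s.
by apply.
Qed.

End quotient.

Section one_sided_limits.
Context {R : realType} {T : R} {Z : topologicalType}.
Implicit Types (f : timeI T -> Z) (t : timeI T) (z : Z).

Definition tends_right f t z : Prop :=
  f s @[s --> within [set s | set_val t < set_val s] (nbhs t)] --> z.

Definition tends_left f t z : Prop :=
  f s @[s --> within [set s | set_val s < set_val t] (nbhs t)] --> z.

(* f(t+) and f(t-), with f(T+) = f(T) and f(0-) = f(0); also f(t) when the limit
   does not exist. *)
Definition right_limit f t : Z :=
  if set_val t < T then xget (f t) [set z | tends_right f t z] else f t.

Definition left_limit f t : Z :=
  if 0 < set_val t then xget (f t) [set z | tends_left f t z] else f t.

Definition jump_set f : set (timeI T) :=
  [set t | left_limit f t <> right_limit f t].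

End one_sided_limits.

Section evolution.
Context {R : realType} (T : R) {X : metricType R} (E : R -> X -> R).
Variables (omega : R -> X -> X) (x0 : X).

(* In the integer case this is T / d - 1. *)
Definition nsteps (d : R) : nat :=
  let n := Num.truncn (T / d) in if T / d == n%:R then n.-1 else n.

Fixpoint qs_step (d : R) (i : nat) : X :=
  if i is j.+1 then omega (i%:R * d) (qs_step d j) else x0.

(* For t >= 0, [truncn (t / d)] is the i such that t is in [i d, (i + 1) d);
   the value is frozen from the time [nsteps d * d] on. *)
Definition evolution (d t : R) : X :=
  qs_step d (minn (nsteps d) (Num.truncn (t / d))).

Definition energy_along (d t : R) : R := E t (evolution d t).

(* The times [i d] with 1 <= i <= nsteps d lie in the open interval (0, T), so
   both one-sided limits are genuine ones. *)
Definition energy_drop (d t : R) : R :=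
  lim (energy_along d s @[s --> t^'-]) - lim (energy_along d s @[s --> t^'+]).

Definition mu_step (d : R) (B : set R) : R :=
  \sum_(1 <= i < (nsteps d).+1 | i%:R * d \in B) energy_drop d (i%:R * d).

(* The integral of [phi] with respect to [mu_step d], a finite combination of
   Dirac masses whose coefficients have no sign a priori. *)
Definition mu_step_integral (d : R) (phi : R -> R) : R :=
  \sum_(1 <= i < (nsteps d).+1) phi (i%:R * d) * energy_drop d (i%:R * d).

Lemma mu_step_integral_indic (d : R) (B : set R) :
  mu_step_integral d \1_B = mu_step d B.
Proof.
rewrite /mu_step_integral /mu_step [RHS]big_mkcond/=; apply: eq_bigr => i _.
by rewrite indicE; case: ifPn => _; rewrite ?mul1r ?mul0r.
Qed.

Definition power_along (d t : R) : R := partial_t T E t (evolution d t).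

Definition ess_bounded (D : R -> R) : Prop :=
  measurable_fun `[0, T] D /\
  exists M : R, {ae (@lebesgue_measure R), forall t, t \in `[0, T] -> `|D t| <= M}.

(* A finite Borel measure on [0,T] (all of them are Radon), seen as a measure on
   the real line. *)
Definition carried (mu : {finite_measure set (measurableTypeR R) -> \bar R})
  : Prop := mu (~` `[0, T]) = 0%E.

Definition qs_convergence (delta : nat -> R)
    (mu : {finite_measure set (measurableTypeR R) -> \bar R})
    (Ebar D : R -> R) : Prop :=
  [/\ [/\ carried mu, bounded_variation 0 T Ebar & ess_bounded D],
      forall phi : R -> R, {within `[0, T], continuous phi} ->
        mu_step_integral (delta n) phi @[n --> \oo]
          --> \int[mu]_(t in `[0, T]) phi t,
      forall t, t \in `[0, T] ->
        energy_along (delta n) t @[n --> \oo] --> Ebar t &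
      forall g : R -> R, (@lebesgue_measure R).-integrable `[0, T] (EFin \o g) ->
        \int[@lebesgue_measure R]_(t in `[0, T]) (power_along (delta n) t * g t)
          @[n --> \oo]
          --> \int[@lebesgue_measure R]_(t in `[0, T]) (D t * g t)].

Definition vanishing_steps (delta : nat -> R) : Prop :=
  [/\ forall n, 0 < delta n, decreasing_seq delta &
      delta n @[n --> \oo] --> (0 : R)].

Definition energy_decreasing_rule : Prop :=
  forall t x, t \in `[0, T] -> E t (omega t x) <= E t x.

Definition critical_rule : Prop :=
  forall t x, t \in `[0, T] -> slope (E t) (omega t x) = 0%E.

Definition dissipative_jumps_rule : Prop :=
  forall (delta : nat -> R)
    (mu : {finite_measure set (measurableTypeR R) -> \bar R})
    (Ebar D : R -> R),
  vanishing_steps delta -> qs_convergence delta mu Ebar D ->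
  forall (t : R) (t1 t2 : nat -> R) (x1 x2 : X),
  t \in `[0, T] ->
  (forall n, [/\ t1 n \in `[0, T], t2 n \in `[0, T] & t1 n <= t2 n]) ->
  t1 n @[n --> \oo] --> t -> t2 n @[n --> \oo] --> t ->
  evolution (delta n) (t1 n) @[n --> \oo] --> x1 ->
  evolution (delta n) (t2 n) @[n --> \oo] --> x2 ->
  crit E t x1 -> crit E t x2 -> ~ path_joined (R := R) (crit E t) x1 x2 ->
  exists c : R, [/\ 0 < c, (c%:E <= mu [set t])%E & c <= E t x1 - E t x2].

End evolution.

Definition atoms {R : realType} (T : R)
    (mu : {finite_measure set (measurableTypeR R) -> \bar R}) : set (timeI T) :=
  [set t | mu [set set_val t] <> 0%E].
Arguments atoms {R} T mu.

(* Main.v *)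
Require Import Defs.
From HB Require Import structures.
From mathcomp Require Import all_boot all_order all_algebra.
From mathcomp Require Import all_classical all_reals all_analysis.
From mathcomp Require Import measurable_realfun lra ring.

(* By Gronwall's inequality the discrete evolutions stay in one compact sublevel,
   hence converge at every time along an ultrafilter on the indices; let [y t] be
   the limit and [etahat t] the class of [(t, y t)].

   Two accumulation points of [y] at [t] from the same side are approached along
   interlaced times in either order. If they lay in different components of the
   critical set, Axiom 3 would make the energy drop strictly from the first to the
   second and from the second to the first. So one-sided limits exist, and the
   same argument gives continuity at every [t] that is not an atom, where Axiom 3
   rules out even a single drop.

   The exact discrete energy balance passes to the limit once the functions
   [t |-> mu^delta([0, t])] are: integrating piecewise linear cut-offs, their
   pointwise limit [F] satisfies [F a <= mu([0, b])] and [mu([0, a]) <= F b] for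
   [a < b], so that [F(t+) = mu([0, t])] and [F(t-) = mu([0, t[)].

   One-sided limits in the quotient are unique because it is a Hausdorff space. *)

Set Implicit Arguments.
Unset Strict Implicit.
Unset Printing Implicit Defensive.

Import Order.TTheory GRing.Theory Num.Theory.
Import numFieldNormedType.Exports.

Local Open Scope classical_set_scope.
Local Open Scope ring_scope.

(** * Filters and subsequences *)

Section filters.

(** There are uncountably many times, so a diagonal extraction alone cannot fix a limit at each of
    them; the ultrafilter does it at once. Axiom 3, however, speaks of sequences. It is reached by
    extracting diagonal subsequences, to which it applies because vanishing steps and (C) pass to
    subsequences. A genuine subsequence reappears only for (v).

    The discrete balance is exact because the state is frozen between updates. Axiom 1 makes every
    drop nonnegative, which lets cut-offs bound [mu^delta([0, t])] from both sides. Cut-offs are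
    needed because the weak-* convergence of the measures only tests continuous functions, while the
    indicator of [[0, t]] is discontinuous at a possible atom. For the powers the test functions are
    merely integrable, and the indicator itself is admissible.

    For the Hausdorff property the danger is that components of nearby critical sets join points
    that are limits of distinct classes. Constancy of the energy on components confines them to one
    compact sublevel, where limits of crossing points exist and are again critical. *)

Lemma within_continuous_cvg (U V : topologicalType) (A : set U) (f : U -> V)
    (I : Type) (F : set_system I) (g : I -> U) (p : U) : Filter F ->
  {within A, continuous f} -> A p -> (\forall i \near F, A (g i)) ->
  g i @[i --> F] --> p -> f (g i) @[i --> F] --> f p.
Proof.
move=> FF /subspace_continuousP cf Ap FA gp W /(cf _ Ap) fW.
have {}fW : nbhs p [set u | A u -> W (f u)] by exact: fW.
by apply: filterS2 FA (gp _ fW) => i Ai; exact.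
Qed.

Lemma ultra_cvg_compact (T : topologicalType) (I : Type) (F : set_system I)
    (A : set T) (f : I -> T) : UltraFilter F -> compact A ->
  (\forall i \near F, A (f i)) -> exists2 p, A p & f i @[i --> F] --> p.
Proof.
move=> FU cA FA; have [p [Ap clp]] := cA (f @ F) _ FA.
exists p => // V Vp; have [//|FnV] := in_ultra_setVsetC (f @^-1` V) FU.
by have [q []] := clp (~` V) _ FnV Vp.
Qed.

(** The device by which convergence in the quotient is proved. If it fails, some open [W] is missed
    on a set that [F] does not exclude, and an ultrafilter finer than [F] concentrates there.
    Compactness then gives a limit along it, and identifying the class of that limit with [z]
    contradicts the avoidance of [W]. *)
Lemma ultra_not_cvg (Z : topologicalType) (I : Type) (F : set_system I)
    (f : I -> Z) (z : Z) : ProperFilter F -> ~ (f i @[i --> F] --> z) ->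
  exists2 G : set_system I, UltraFilter G /\ F `<=` G &
    exists2 W : set Z, open W /\ W z & \forall i \near G, ~ W (f i).
Proof.
move=> FF nfz.
have [W [oW Wz] nW] : exists2 W, open W /\ W z & ~ F (f @^-1` W).
  apply: contrapT => h; apply: nfz => V; rewrite nbhsE => -[W [oW Wz] WV].
  apply: (@filterS _ F _ (f @^-1` W)); first by move=> i; exact: WV.
  by apply: contrapT => nW; apply: h; exists W.
have FW : ProperFilter (within (~` (f @^-1` W)) F).
  apply: Build_ProperFilter_ex => P FP; apply: contrapT => nP; apply: nW.
  have {}FP : F [set i | ~ W (f i) -> P i] by [].
  apply: filterS FP => i h; apply: contrapT => nWi; apply: nP.
  by exists i; exact: h.
have [G [GU WG]] := ultraFilterLemma FW.
exists G; first by split=> // P FP; apply: WG; exact: filterS FP.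
by exists W => //; apply: WG; exact: (@filterE _ F).
Qed.

Lemma choice_on (A B : Type) (b : B) (dom : set A) (Q : A -> B -> Prop) :
  (forall a, dom a -> exists b, Q a b) ->
  exists f : A -> B, forall a, dom a -> Q a (f a).
Proof.
move=> h; have h' a : exists b, dom a -> Q a b.
  by have [/h[c Qc]|nd] := pselect (dom a); [exists c|exists b].
by have [f fP] := choice h'; exists f.
Qed.

Lemma increasing_choice (P : nat -> nat -> Prop) :
  (forall m N, exists2 n, (N <= n)%N & P m n) ->
  exists2 k : nat -> nat, {homo k : m n / (m < n)%N} & forall m, P m (k m).
Proof.
move=> h.
have c m N : {n | (N <= n)%N /\ P m n}.
  by apply: cid; have [n] := h m N; exists n.
pose k := fix k m :=
  if m is m'.+1 then sval (c m (k m').+1) else sval (c 0%N 0%N).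
have kS m : (k m < k m.+1)%N /\ P m.+1 (k m.+1) by exact: svalP (c m.+1 (k m).+1).
exists k; first by apply: homo_ltn => [|m]; [exact: ltn_trans|have [] := kS m].
by case=> [|m]; [have [] := svalP (c 0%N 0%N)|have [] := kS m].
Qed.

Lemma increasing_seq_ge (k : nat -> nat) :
  {homo k : m n / (m < n)%N} -> forall n, (n <= k n)%N.
Proof. by move=> hk; elim=> // n IH; apply: leq_ltn_trans IH (hk _ _ (ltnSn n)). Qed.

Lemma cvg_increasing (k : nat -> nat) :
  {homo k : m n / (m < n)%N} -> k n @[n --> \oo] --> \oo.
Proof.
move=> hk P [N _ NP]; exists N => // n /= Nn; apply: NP => /=.
by rewrite (leq_trans Nn)// increasing_seq_ge.
Qed.

End filters.

Section metric.
Context {R : realType} {X : metricType R}.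

Lemma cvg_mdist_inv (u : nat -> X) (x : X) :
  (forall n, mdist x (u n) < n.+1%:R^-1) -> u n @[n --> \oo] --> x.
Proof.
move=> h; apply/metricType_numDomainType.cvgrPdist_lt => e e0.
near=> n; apply: lt_trans (h n) _.
by near: n; exact: near_infty_natSinv_lt (PosNum e0).
Unshelve. all: by end_near. Qed.

End metric.

(** * Regularity and growth of the energy *)

Section energy_along_filters.
Context {R : realType} {X : metricType R} (T : R) (E : R -> X -> R).
Hypothesis hA2 : energy_regular T E.
Context {I : Type} (F : set_system I) {FF : ProperFilter F}.
Variables (tt : I -> R) (xx : I -> X) (t : R) (x : X).
Hypotheses (t01 : t \in `[0, T]) (ttF : \forall i \near F, tt i \in `[0, T]).
Hypotheses (ttt : tt i @[i --> F] --> t) (xxx : xx i @[i --> F] --> x).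

Let pair_cvg (f : R * X -> R) : {within `[0, T] `*` setT, continuous f} ->
  f (tt i, xx i) @[i --> F] --> f (t, x).
Proof.
move=> cf; apply: (@within_continuous_cvg _ _ _ f I F (fun i => (tt i, xx i)) (t, x) _ cf).
- by split.
- by apply: filterS ttF => i ti; split.
- exact: cvg_pair ttt xxx.
Qed.

Lemma energy_cvg : E (tt i) (xx i) @[i --> F] --> E t x.
Proof. by case: hA2 => /pair_cvg. Qed.

Lemma partial_t_cvg :
  partial_t T E (tt i) (xx i) @[i --> F] --> partial_t T E t x.
Proof. by case: hA2 => _ _ /pair_cvg. Qed.

Lemma slope_cvg :
  fine (slope (E (tt i)) (xx i)) @[i --> F] --> fine (slope (E t) x).
Proof. by case: hA2 => _ _ _ _ /pair_cvg. Qed.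

(** Zero slope is a closed condition by continuity of the slope. Since [fine] also sends infinite
    values to 0, finiteness of the slope is what allows the conclusion to return to extended
    reals. *)
Lemma crit_cvg : (\forall i \near F, crit E (tt i) (xx i)) -> crit E t x.
Proof.
move=> Fc; have [_ _ _ fin _] := hA2.
have c0 : fine (slope (E (tt i)) (xx i)) @[i --> F] --> (0 : R).
  apply: cvg_near_cst; apply: filterS Fc => i ci.
  by rewrite /crit/= in ci; rewrite ci.
rewrite /crit /= -[LHS]fineK ?fin//.
by rewrite (cvg_unique _ slope_cvg c0).
Qed.

End energy_along_filters.

Section time_derivative.
Context {R : realType} {X : metricType R} (T : R) (E : R -> X -> R).
Hypothesis hA2 : energy_regular T E.

Lemma energy_continuous (x : X) : {within `[0, T], continuous (E ^~ x)}.
Proof.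
apply/subspace_continuousP => t t01.
have PF := within_nbhs_proper (A := `[0, T]%classic) (subset_closure t01).
apply: (energy_cvg hA2 t01); last exact: cvg_cst.
- exact: withinT.
- exact: cvg_within.
Qed.

Lemma partial_t_continuous (x : X) :
  {within `[0, T], continuous ((partial_t T E) ^~ x)}.
Proof.
apply/subspace_continuousP => t t01.
have PF := within_nbhs_proper (A := `[0, T]%classic) (subset_closure t01).
apply: (partial_t_cvg hA2 t01); last exact: cvg_cst.
- exact: withinT.
- exact: cvg_within.
Qed.

(** [partial_t] is a limit along times of [0,T] only; at an interior time this restriction is void,
    and the limit is the ordinary two-sided derivative. *)
Lemma energy_is_derive (x : X) (t : R) : t \in `]0, T[ ->
  is_derive t 1 (E ^~ x) (partial_t T E t x).
Proof.
move=> t0T; have t01 := subset_itv_oo_cc t0T.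
have [_ /(_ t x t01) cvgq _ _ _] := hA2.
have {}cvgq : time_quotient E t x s @[s --> t^'] --> partial_t T E t x.
  apply: cvg_trans cvgq; apply: cvg_app => P hP.
  have {}hP : \forall s \near t, s != t -> s \in `[0, T] -> P s by [].
  apply: filterS2 (near_in_itvoo t0T) hP => s sI h st.
  exact: h st (subset_itv_oo_cc sI).
have hd : h^-1 *: ((E ^~ x \o shift t) h - E t x) @[h --> 0^'] --> partial_t T E t x.
  have e h : h^-1 *: ((E ^~ x \o shift t) h - E t x) = time_quotient E t x (h + t).
    by rewrite /time_quotient addrK /= mulrC.
  under eq_cvg do rewrite e.
  apply: (cvg_comp (fun h => h + t) (time_quotient E t x) _ cvgq) => P tP.
  have {}tP : \forall s \near t, s != t -> P s by [].
  have c : (h + t) @[h --> 0] --> t.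
    by rewrite -[X in _ --> X]add0r; apply: cvgD; [exact: cvg_id|exact: cvg_cst].
  suff : \forall h \near (0 : R), h != 0 -> P (h + t) by [].
  have ctP : \forall h \near (0 : R), h + t != t -> P (h + t) by exact: c _ tP.
  near=> h => h0.
  have : h + t != t -> P (h + t) by near: h.
  by apply; rewrite -subr_eq0 addrK.
have eq1 : (fun h => h^-1 *: ((E ^~ x \o shift t) (h *: 1) - E t x)) =
    (fun h => h^-1 *: ((E ^~ x \o shift t) h - E t x)).
  by apply/funext => h /=; rewrite /GRing.scale /= mulr1.
split; first by apply/cvg_ex; exists (partial_t T E t x); rewrite eq1; exact: hd.
by apply: cvg_lim => //; rewrite eq1.
Unshelve. all: by end_near. Qed.

End time_derivative.

(** * Growth estimates and compact sublevels uniform in time *)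

Section gronwall.
Context {R : realType} {X : metricType R} (T : R) (E : R -> X -> R).
Hypothesis hA2 : energy_regular T E.
Variables C1 C2 : R.
Hypotheses (C1_gt0 : 0 < C1).
Hypothesis power_le : forall t x, t \in `[0, T] ->
  `|partial_t T E t x| <= C1 * E t x + C2.

Let growth (x : X) (t : R) := C1 * E t x + C2.

Let exp_growth (c : R) (x : X) (t : R) := expR (c * t) * growth x t.

Let exp_growth_continuous (c : R) (x : X) :
  {within `[0, T], continuous (exp_growth c x)}.
Proof.
apply/subspace_continuousP => t t01; apply: cvgM.
- have ce : continuous (fun s : R => expR (c * s)).
    move=> s; apply: (@continuous_comp _ _ _ (fun s => c * s) expR).
      by apply: cvgM; [exact: cvg_cst|exact: cvg_id].
    exact: continuous_expR.
  apply: (cvg_trans _ (ce t)); apply: cvg_app; exact: cvg_within.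
- apply: cvgD; last exact: cvg_cst.
  apply: cvgM; first exact: cvg_cst.
  by have /subspace_continuousP := @energy_continuous _ _ _ _ hA2 x; apply.
Qed.

Let exp_growth_is_derive (c : R) (x : X) (t : R) : t \in `]0, T[ ->
  is_derive t 1 (exp_growth c x)
    (expR (c * t) * (C1 * partial_t T E t x + c * growth x t)).
Proof.
move=> t0T; have dE := energy_is_derive hA2 x t0T.
have dG : is_derive t 1 (growth x) (C1 * partial_t T E t x).
  apply: is_derive_eq; rewrite /GRing.scale/=; ring.
have de : is_derive t 1 (fun s => expR (c * s)) (c * expR (c * t)).
  apply: is_derive_eq; rewrite /GRing.scale/=; ring.
apply: is_derive_eq; rewrite /GRing.scale/=; ring.
Qed.

Let exp_growth_derivable (c : R) (x : X) :
  forall t, t \in `]0, T[ -> derivable (exp_growth c x) t 1.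
Proof. by move=> t /(exp_growth_is_derive c x) []. Qed.

(** By (A3), [C1 * E + C2] has a time derivative bounded by [C1] times itself. Multiplied by
    [expR (C1 * t)] it is nondecreasing, multiplied by [expR (- C1 * t)] nonincreasing; one factor
    serves [s <= t], the other [t < s]. Both directions are needed to bound the energy at all times
    from a bound at a single one. *)
Lemma gronwall (x : X) (s t : R) : s \in `[0, T] -> t \in `[0, T] ->
  C1 * E s x + C2 <= expR (C1 * `|s - t|) * (C1 * E t x + C2).
Proof.
move=> s01 t01; rewrite -/(growth x s) -/(growth x t).
have [/andP[s0 sT] /andP[t0 tT]] : 0 <= s <= T /\ 0 <= t <= T.
  by move: s01 t01; rewrite !in_itv.
have [st|ts] := leP s t.
- have : exp_growth C1 x s <= exp_growth C1 x t.
    apply: (@ger0_derive1_ndecr _ (exp_growth C1 x) 0 T _ _ _ s t s0 st tT).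
    - exact: exp_growth_derivable.
    - move=> r rI; have dr := exp_growth_is_derive C1 x rI.
      rewrite derive1E (@derive_val _ _ _ _ _ _ _ dr).
      rewrite mulr_ge0 ?expR_ge0// -mulrDr mulr_ge0 ?(ltW C1_gt0)//.
      have := power_le x (subset_itv_oo_cc rI); rewrite ler_norml => /andP[+ _].
      by rewrite -subr_ge0 opprK addrC.
    - exact: exp_growth_continuous.
  rewrite /exp_growth -(ler_pM2l (expR_gt0 (- (C1 * s)))) !mulrA -!expRD.
  by rewrite addNr expR0 mul1r addrC -mulrBr distrC ger0_norm// subr_ge0.
- have : exp_growth (- C1) x s <= exp_growth (- C1) x t.
    apply: (@ler0_derive1_nincr _ (exp_growth (- C1) x) 0 T _ _ _ t s t0 (ltW ts) sT).
    - exact: exp_growth_derivable.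
    - move=> r rI; have dr := exp_growth_is_derive (- C1) x rI.
      rewrite derive1E (@derive_val _ _ _ _ _ _ _ dr).
      rewrite pmulr_rle0 ?expR_gt0// mulNr -mulrBr pmulr_rle0// subr_le0.
      by apply: le_trans (power_le x (subset_itv_oo_cc rI)); exact: ler_norm.
    - exact: exp_growth_continuous.
  rewrite /exp_growth -(ler_pM2l (expR_gt0 (C1 * s))) !mulrA -!expRD.
  by rewrite mulNr addrN expR0 mul1r mulNr -mulrBr gtr0_norm// subr_gt0.
Qed.

(** (A3) forces [C1 * E + C2 >= 0], which bounds [E] from below; Gronwall over a duration of at most
    [T] bounds it from above. The term [|C2|] absorbs the shift by [C2] in both bounds of the
    absolute value. *)
Lemma sup_energy_le (c : R) (t : R) (x : X) : t \in `[0, T] -> E t x <= c ->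
  (sup_energy T E x <= ((expR (C1 * T) * (C1 * c + C2) + `|C2|) / C1)%:E)%E.
Proof.
move=> t01 Etc; apply: ge_ereal_sup => _ [s sT <-]; rewrite lee_fin.
have s01 : s \in `[0, T] by [].
have [/andP[s0 {}sT] /andP[t0 tT]] : 0 <= s <= T /\ 0 <= t <= T.
  by move: s01 t01; rewrite !in_itv.
have gs : 0 <= growth x s by apply: le_trans (power_le x s01).
have gt : 0 <= growth x t by apply: le_trans (power_le x t01).
have gst := gronwall x s01 t01.
have est : expR (C1 * `|s - t|) <= expR (C1 * T).
  rewrite ler_expR ler_pM2l// ler_norml.
  by apply/andP; split; lra.
have h : growth x s <= expR (C1 * T) * (C1 * c + C2).
  apply: le_trans gst _; apply: ler_pM => //.
  by rewrite lerD2r ler_pM2l.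
have h0 := le_trans gs h.
rewrite ler_pdivlMr// -(gtr0_norm C1_gt0) -normrM (gtr0_norm C1_gt0) mulrC.
have := ler_norm C2; have := ler_norm (- C2); rewrite normrN.
by rewrite /growth in gs h h0 *; rewrite ler_norml => c1 c2; apply/andP; split; lra.
Qed.

End gronwall.

Section sublevels.
Context {R : realType} {X : metricType R} (T : R) (E : R -> X -> R).
Hypotheses (hA2 : energy_regular T E) (hA3 : power_control T E).
Hypothesis hA4 : compact_sublevels T E.

Lemma sublevels_compact (c : R) : exists2 K : set X, compact K &
  forall t x, t \in `[0, T] -> E t x <= c -> K x.
Proof.
have [C1 [C2 [C1_gt0 C2_gt0 power_le]]] := hA3.
exists [set x | (sup_energy T E x <=
  ((expR (C1 * T) * (C1 * c + C2) + `|C2|) / C1)%:E)%E]; first exact: hA4.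
by move=> t x t01 Etc; exact (sup_energy_le hA2 C1_gt0 power_le t01 Etc).
Qed.

End sublevels.

(** * Step times and the index of the current step *)

Section steps.
Context {R : realType} (T : R) (T_gt0 : 0 < T) (d : R) (d_gt0 : 0 < d).

Lemma nsteps_lt : (nsteps T d)%:R * d < T.
Proof.
rewrite -ltr_pdivlMr//; have Td : 0 < T / d by rewrite divr_gt0.
rewrite /nsteps; case: eqVneq => [e|ne].
  rewrite [ltRHS]e ltr_nat ltn_predL -(ltr0n R) -e//.
have /andP[] := truncn_itv (ltW Td); rewrite le_eqVlt => /orP[|//].
by rewrite eq_sym (negbTE ne).
Qed.

Lemma nsteps_gt : T <= (nsteps T d).+1%:R * d.
Proof.
rewrite -ler_pdivrMr//; have Td : 0 < T / d by rewrite divr_gt0.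
have /andP[_ lt1] := truncn_itv (ltW Td).
rewrite /nsteps; case: eqVneq => [e|ne]; last exact: ltW.
by rewrite prednK -?e// -(ltr0n R) -e.
Qed.

Lemma step_time (i : nat) : (i <= nsteps T d)%N -> i%:R * d \in `[0, T].
Proof.
move=> iM; rewrite in_itv/= mulr_ge0 ?ler0n ?(ltW d_gt0)//=.
by apply: le_trans (ltW nsteps_lt); rewrite ler_pM2r// ler_nat.
Qed.

Definition step_index (t : R) : nat := minn (nsteps T d) (Num.truncn (t / d)).

(** The right inequality is not strict: when [T / d] is an integer, the last state lasts up to [T],
    which is then exactly [(nsteps T d).+1 * d]. *)
Lemma step_index_itv (t : R) : t \in `[0, T] ->
  (step_index t)%:R * d <= t <= (step_index t).+1%:R * d.
Proof.
rewrite in_itv/= => /andP[t0 tT].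
have td : 0 <= t / d by rewrite divr_ge0// ltW.
have /andP[h1 h2] := truncn_itv td.
have e1 (x : R) : (x * d <= t) = (x <= t / d) by rewrite ler_pdivlMr.
have e2 (x : R) : (t <= x * d) = (t / d <= x) by rewrite ler_pdivrMr.
rewrite e1 e2 /step_index.
have [le|ge] := leqP (nsteps T d) (Num.truncn (t / d)).
  apply/andP; split.
    by apply: le_trans h1; rewrite ler_nat.
  by rewrite ler_pdivrMr// (le_trans tT)// nsteps_gt.
by rewrite h1 ltW.
Qed.

Lemma step_index_eq (i : nat) (t : R) : (i <= nsteps T d)%N ->
  i%:R * d <= t -> (t < i.+1%:R * d \/ (i = nsteps T d)) -> step_index t = i.
Proof.
move=> iM it ti; have t0 : 0 <= t by apply: le_trans it; rewrite mulr_ge0// ltW.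
have td : 0 <= t / d by rewrite divr_ge0// ltW.
have /andP[h1 h2] := truncn_itv td.
have le1 : (i <= Num.truncn (t / d))%N by rewrite truncn_ge_nat// ler_pdivlMr.
rewrite /step_index; case: ti => [ti|<-]; last exact/minn_idPl.
have -> : Num.truncn (t / d) = i.
  by apply/eqP; rewrite eqn_leq le1 andbT truncn_le_nat ltr_pdivrMr.
exact/minn_idPr.
Qed.

End steps.

(** * Compactness of the discrete evolutions and criticality of their limits *)

Section evolution_bounds.
Context {R : realType} {X : metricType R} (T : R) (E : R -> X -> R).
Hypothesis T_gt0 : 0 < T.
Variables (omega : R -> X -> X) (x0 : X).
Hypothesis hx0 : slope (E 0) x0 = 0%E.
Hypothesis hAx2 : critical_rule T E omega.

(** The state is critical at the time of its last update, not at [t] itself. Before the first update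
    this is the criticality of [x0], afterwards Axiom 2. *)
Lemma evolution_crit (d t : R) : 0 < d ->
  crit E ((step_index T d t)%:R * d) (evolution T omega x0 d t).
Proof.
move=> d_gt0; rewrite /evolution -/(step_index T d t).
have : (step_index T d t <= nsteps T d)%N by exact: geq_minl.
case: (step_index T d t) => [_|i iM]; first by rewrite mul0r.
by rewrite /crit/=; apply: hAx2; exact: step_time.
Qed.

Hypotheses (hA2 : energy_regular T E) (hA3 : power_control T E).
Hypothesis hA4 : compact_sublevels T E.
Hypothesis hAx1 : energy_decreasing_rule T E omega.

(** At an update Axiom 1 does not increase the energy, and between two updates Gronwall costs a
    factor [expR (C1 * d)]. After [i] steps the factors multiply to [expR (C1 * (i * d))], at most
    [expR (C1 * T)], so the bound does not depend on [d]. *)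
Lemma evolution_compact : exists2 K : set X, compact K &
  forall d t, 0 < d -> K (evolution T omega x0 d t).
Proof.
have [C1 [C2 [C1_gt0 C2_gt0 power_le]]] := hA3.
have growth0 t x : t \in `[0, T] -> 0 <= C1 * E t x + C2.
  by move=> t01; apply: le_trans (power_le t x t01).
have T0 : 0 \in `[0, T] by rewrite in_itv/= lexx ltW.
have bnd d i : 0 < d -> (i <= nsteps T d)%N ->
    C1 * E (i%:R * d) (qs_step omega x0 d i) + C2 <=
    expR (C1 * (i%:R * d)) * (C1 * E 0 x0 + C2).
  move=> d_gt0; elim: i => [_|i IH iM].
    by rewrite /= mul0r mulr0 expR0 mul1r.
  have h1 := step_time T_gt0 d_gt0 (ltnW iM); have h2 := step_time T_gt0 d_gt0 iM.
  have step : C1 * E (i.+1%:R * d) (qs_step omega x0 d i.+1) + C2 <=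
      C1 * E (i.+1%:R * d) (qs_step omega x0 d i) + C2.
    by rewrite lerD2r ler_pM2l//; exact: hAx1.
  apply: le_trans step _.
  apply: le_trans (gronwall hA2 C1_gt0 power_le (qs_step omega x0 d i) h2 h1) _.
  rewrite -mulrBl -natrB// subSnn mul1r gtr0_norm//.
  have -> : C1 * (i.+1%:R * d) = C1 * d + C1 * (i%:R * d) by rewrite -natr1; ring.
  by rewrite expRD -mulrA ler_pM2l ?expR_gt0// IH// ltnW.
have [K cK KP] := sublevels_compact hA2 hA3 hA4
  ((expR (C1 * T) * (C1 * E 0 x0 + C2)) / C1).
exists K => // d t d_gt0; rewrite /evolution; set i := minn _ _.
have iM : (i <= nsteps T d)%N by exact: geq_minl.
have id01 := step_time T_gt0 d_gt0 iM.
apply: (KP (i%:R * d)) => //; rewrite ler_pdivlMr// mulrC.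
have := bnd d i d_gt0 iM; have : expR (C1 * (i%:R * d)) * (C1 * E 0 x0 + C2) <=
    expR (C1 * T) * (C1 * E 0 x0 + C2).
  apply: ler_pM => //; first exact: growth0.
  by rewrite ler_expR ler_pM2l//; move: id01; rewrite in_itv/= => /andP[].
by move=> h1 h2; lra.
Qed.

(** The last update precedes [s i] by at most [d i], so the update times, at which the states are
    critical, also tend to [t]. *)
Lemma evolution_limit_crit (I : Type) (F : set_system I) (FF : ProperFilter F)
    (d s : I -> R) (t : R) (x : X) :
  (forall i, 0 < d i) -> d i @[i --> F] --> 0 ->
  (\forall i \near F, s i \in `[0, T]) -> s i @[i --> F] --> t -> t \in `[0, T] ->
  evolution T omega x0 (d i) (s i) @[i --> F] --> x -> crit E t x.
Proof.
move=> d_gt0 d0 s01 st t01 ex.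
apply: (crit_cvg hA2 t01 (tt := fun i => (step_index T (d i) (s i))%:R * d i) _ _ ex).
- by apply: filterE => i; apply: step_time => //; exact: geq_minl.
- apply: (squeeze_cvgr (f := fun i => s i - d i) (h := s)) => //.
    near=> i.
    have /(step_index_itv T_gt0 (d_gt0 i)) /andP[-> +] : s i \in `[0, T] by near: i.
    by rewrite andbT -natr1 mulrDl mul1r lerBlDr.
  rewrite -[X in _ --> X]subr0; exact: cvgB.
- by apply: filterE => i; exact: evolution_crit.
Unshelve. all: by end_near. Qed.

End evolution_bounds.

(** * The jump alternative *)

Section subsequences.
Context {R : realType} {X : metricType R} (T : R) (E : R -> X -> R).
Variables (omega : R -> X -> X) (x0 : X) (delta : nat -> R).
Variables (mu : {finite_measure set (measurableTypeR R) -> \bar R}).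
Variables (Ebar D : R -> R) (k : nat -> nat).
Hypothesis hk : {homo k : m n / (m < n)%N}.

Lemma vanishing_steps_subseq :
  vanishing_steps delta -> vanishing_steps (delta \o k).
Proof.
move=> [d_gt0 decr d0]; split=> [n|m n|]; first exact: d_gt0.
  rewrite /= decr; apply/idP/idP; last first.
    by rewrite leq_eqVlt => /orP[/eqP->//|/hk/ltnW].
  by rewrite leqNgt => h; rewrite leqNgt; apply: contra h => /hk.
exact: (cvg_comp _ _ (cvg_increasing hk) d0).
Qed.

Lemma qs_convergence_subseq :
  qs_convergence T E omega x0 delta mu Ebar D ->
  qs_convergence T E omega x0 (delta \o k) mu Ebar D.
Proof.
move=> [reg cmu cE cD]; split; [exact: reg|move=> phi cphi|move=> t tT|move=> g ig].
- exact: (cvg_comp _ _ (cvg_increasing hk) (cmu phi cphi)).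
- exact: (cvg_comp _ _ (cvg_increasing hk) (cE t tT)).
- exact: (cvg_comp _ _ (cvg_increasing hk) (cD g ig)).
Qed.

End subsequences.

Section jump_alternative.
Context {R : realType} {X : metricType R} (T : R) (E : R -> X -> R).
Hypotheses (T_gt0 : 0 < T) (hA2 : energy_regular T E).
Variables (delta : nat -> R) (omega : R -> X -> X) (x0 : X).
Hypotheses (hdelta : vanishing_steps delta) (hx0 : slope (E 0) x0 = 0%E).
Variables (mu : {finite_measure set (measurableTypeR R) -> \bar R}).
Variables (Ebar D : R -> R).
Hypothesis hC : qs_convergence T E omega x0 delta mu Ebar D.
Hypothesis hAx2 : critical_rule T E omega.
Hypothesis hAx3 : dissipative_jumps_rule T E omega x0.

(** A single tolerance [e] controls both time and space, so that a diagonal choice [e = 1 / (m + 1)]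
    yields convergence of both at once. *)
Definition shadows (e t : R) (x : X) (n : nat) (s : R) : Prop :=
  [/\ s \in `[0, T], `|s - t| < e & mdist x (evolution T omega x0 (delta n) s) < e].

(* Axiom 3 along a diagonal subsequence. *)
Lemma jump_alternative (t : R) (x1 x2 : X) : t \in `[0, T] ->
  (forall e N, 0 < e -> exists n s1 s2,
    [/\ (N <= n)%N, s1 <= s2, shadows e t x1 n s1 & shadows e t x2 n s2]) ->
  path_joined (R := R) (crit E t) x1 x2 \/
  exists c : R, [/\ 0 < c, (c%:E <= mu [set t])%E & c <= E t x1 - E t x2].
Proof.
move=> t01 h; have [|nj] := pselect (path_joined (R := R) (crit E t) x1 x2).
  by left.
right.
have [k hk kP] : exists2 k : nat -> nat, {homo k : m n / (m < n)%N} &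
    forall m, exists s : R * R, [/\ s.1 <= s.2,
      shadows m.+1%:R^-1 t x1 (k m) s.1 & shadows m.+1%:R^-1 t x2 (k m) s.2].
  apply: (@increasing_choice (fun m n => exists s : R * R, [/\ s.1 <= s.2,
      shadows m.+1%:R^-1 t x1 n s.1 & shadows m.+1%:R^-1 t x2 n s.2])) => m N.
  have [|n [s1 [s2 [Nn s12 sh1 sh2]]]] := h m.+1%:R^-1 N.
    by rewrite invr_gt0.
  by exists n => //; exists (s1, s2).
have [s sP] := choice kP.
have [d_gt0 _ d0] := vanishing_steps_subseq hk hdelta.
have s01 (m : nat) : [/\ (s m).1 \in `[0, T], (s m).2 \in `[0, T] & (s m).1 <= (s m).2].
  by have [? [? _ _] [? _ _]] := sP m.
have c1 : (s n).1 @[n --> \oo] --> t.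
  by apply: (@cvg_mdist_inv R R^o) => m; have [_ [_ + _] _] := sP m.
have c2 : (s n).2 @[n --> \oo] --> t.
  by apply: (@cvg_mdist_inv R R^o) => m; have [_ _ [_ + _]] := sP m.
have e1 : evolution T omega x0 ((delta \o k) n) (s n).1 @[n --> \oo] --> x1.
  by apply: cvg_mdist_inv => m; have [_ [_ _ +] _] := sP m.
have e2 : evolution T omega x0 ((delta \o k) n) (s n).2 @[n --> \oo] --> x2.
  by apply: cvg_mdist_inv => m; have [_ _ [_ _ +]] := sP m.
apply: (hAx3 (vanishing_steps_subseq hk hdelta) (qs_convergence_subseq hk hC)
  t01 s01 c1 c2 e1 e2 _ _ nj).
- apply: (evolution_limit_crit T_gt0 hx0 hAx2 hA2 _ d_gt0 d0 _ c1 t01 e1).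
  by apply: filterE => m; have [] := s01 m.
- apply: (evolution_limit_crit T_gt0 hx0 hAx2 hA2 _ d_gt0 d0 _ c2 t01 e2).
  by apply: filterE => m; have [] := s01 m.
Qed.

End jump_alternative.

(** * Topology of the quotient space *)

Section quotient_hausdorff.
Context {R : realType} {X : metricType R} (T : R) (E : R -> X -> R).
Hypotheses (hA2 : energy_regular T E) (hA3 : power_control T E).
Hypotheses (hA4 : compact_sublevels T E) (hA5 : critical_sets_split T E).

Let half01 : (0 : R) < 2^-1 < (1 : R).
Proof. by rewrite invr_gt0 ltr0n invf_lt1 ?ltr1n. Qed.

Lemma path_joined_crit (A : set X) (x y : X) :
  path_joined (R := R) A x y -> A x /\ A y.
Proof.
case=> g [_ <- <- gA]; split; apply: gA.
  by exists 0 => //=; rewrite in_itv/= lexx ler01.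
by exists 1 => //=; rewrite in_itv/= lexx ler01.
Qed.

(** The path up to the parameter where [f] equals [v], rescaled to the unit interval, joins [x] to
    the crossing point inside [A]. *)
Lemma path_joined_ivt (A : set X) (f : X -> R) (x y : X) (v : R) :
  continuous f -> path_joined (R := R) A x y -> f x <= v <= f y ->
  exists2 u, path_joined (R := R) A x u & f u = v.
Proof.
move=> cf [g [cg g0 g1 gA]] fv.
have [||c c01 fc] := @IVT R (f \o g) 0 1 v ler01.
- by apply: subtype_topology.within_continuous_comp cg => u _; exact: cf.
- by rewrite /= g0 g1; move: fv => /andP[fx fy]; rewrite ge_min fx le_max fy orbT.
have [c0 c1] : 0 <= c /\ c <= 1 by move: c01; rewrite in_itv/= => /andP[].
have cI (s : R) : s \in `[0, 1] -> c * s \in `[0, 1].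
  rewrite !in_itv/= => /andP[s0 s1].
  by rewrite mulr_ge0//= mulr_ile1.
exists (g c) => //; exists (fun s => g (c * s)); split.
- apply: Defs.within_continuous_comp cI _ cg => //.
  by move=> s; apply: cvgM; [exact: cvg_cst|exact: cvg_id].
- by rewrite mulr0.
- by rewrite mulr1.
- by move=> _ [s s01 <-]; apply: gA; exists (c * s) => //; exact: cI.
Qed.

Lemma crit_closed (t : R) : t \in `[0, T] -> closed (crit E t).
Proof.
move=> t01 x clx.
have PF := within_nbhs_proper (A := crit E t) clx.
apply: (crit_cvg hA2 t01 (F := within (crit E t) (nbhs x)) (tt := fun=> t) (xx := id)).
- exact: filterE.
- exact: cvg_cst.
- exact: cvg_within.
- exact: withinT.
Qed.

(* Distinct components of a critical set are separated by a Urysohn function,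
   because each of them is compact and relatively open. *)
Lemma component_separator (t : R) (x : X) : t \in `[0, T] -> crit E t x ->
  exists f : X -> R, [/\ continuous f,
    forall y, path_joined (R := R) (crit E t) x y -> f y = 0 &
    forall y, crit E t y -> ~ path_joined (R := R) (crit E t) x y -> f y = 1].
Proof.
move=> t01 cx; have [[F [critF _ sepF cptF joinF]] _] := hA5 t01.
have [K FK Kx] : (\bigcup_(K in F) K) x by rewrite -critF.
have Kc : K `<=` crit E t by move=> y Ky; rewrite critF; exists K.
have clK : closed K by apply: compact_closed; [exact: metric_hausdorff|exact: cptF].
have clD : closed (crit E t `\` K).
  move=> y cly; have cy : crit E t y.
    by apply: (crit_closed t01); apply: closureS cly; exact: subDsetl.
  split=> // Ky; have [r r0 rP] := sepF K FK.
  have yr : nbhs y [set z | mdist y z < r] by apply/metricType_numDomainType.nbhs_mdistP; exists r.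
  have [z [[cz nKz] yz]] := cly _ yr.
  have : r <= mdist y z.
    apply: rP => //; move: cz; rewrite critF => -[L FL Lz]; exists L => //.
    by split=> // LK; apply: nKz; rewrite -LK.
  by rewrite leNgt yz.
have /(@normal_separatorP R) sep := @pseudometric_normal R X.
have /uniform_separatorP := sep _ _ clK clD (setDIK _ _).
move=> /(_ R)[f [cf f01 fK fD]].
have fK0 y : K y -> f y = 0 by move=> Ky; apply: fK; exists y.
have fD1 y : crit E t y -> ~ K y -> f y = 1 by move=> cy Ky; apply: fD; exists y.
have joinK y : K y -> path_joined (R := R) (crit E t) x y.
  move=> Ky; have [g [cg _ g0 g1 gK]] := joinF K FK x y Kx Ky.
  by exists g; split=> //; exact: subset_trans Kc.
exists f; split=> // [y xy|y cy nxy]; last by apply: fD1 => // /joinK.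
have [_ cy] := path_joined_crit xy.
(* [K] is the whole component of [x]: a path leaving it would go from level 0 to level 1 of [f] and
   meet the critical set at level 1/2, a value that [f] does not take there. *)
apply: (fK0 y); apply: contrapT => nKy.
have [|u xu fu] := path_joined_ivt (v := 2^-1) cf xy.
  by rewrite (fK0 x)// (fD1 y)// invr_ge0 ler0n invf_le1 ?ler1n.
have [_ cu] := path_joined_crit xu.
have [Ku|nKu] := pselect (K u).
  by move: half01; rewrite -fu fK0// ltxx.
by move: half01; rewrite -fu fD1// ltxx andbF.
Qed.

Let simR (p p' : timeI T * X) : sim E p p' <-> p = p' \/ (p.1 = p'.1 /\
  path_joined (R := R) (crit E (set_val p.1)) p.2 p'.2).
Proof. by split=> [/asboolP|h]; last exact/asboolP. Qed.

Lemma time_continuous : continuous (fun p : timeI T * X => set_val p.1).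
Proof.
move=> p; apply: (@continuous_comp _ _ _ fst set_val); first exact: cvg_fst.
exact: initial_continuous.
Qed.

Lemma timeP (t : timeI T) : set_val t \in `[0, T].
Proof. by have := set_valP t. Qed.

(* The decomposition into classes is upper semicontinuous: a path in the critical
   set at a nearby time cannot leave a component without crossing the level 1/2
   of a separator, at a point that accumulates on the critical set. *)
Lemma class_upper_semicontinuous (V : set (timeI T * X)) (p0 : timeI T * X) :
  open V -> (forall p, sim E p0 p -> V p) ->
  \forall p \near p0, forall p', sim E p p' -> V p'.
Proof.
move=> oV Vp0; apply: contrapT => nn.
pose B := [set p : timeI T * X | exists p', sim E p p' /\ ~ V p'].
have PG : ProperFilter (within B (nbhs p0)).
  apply: Build_ProperFilter_ex => P nP; apply: contrapT => nexP; apply: nn.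
  have {}nP : \forall p \near p0, B p -> P p by exact: nP.
  apply: filterS nP => p Pp p' pp'; apply: contrapT => nVp'.
  by apply: nexP; exists p; apply: Pp; exists p'.
have [G [GU leG]] := ultraFilterLemma PG.
have Gp0 : G --> p0 by move=> P nP; apply: leG; apply: filterS nP => p.
have GB : G B by apply: leG; exact: withinT.
have GV : G V by apply: Gp0; apply: open_nbhs_nbhs; split=> //; apply: Vp0; exact: sim_refl.
have [w wP] : exists w : timeI T * X -> timeI T * X,
    forall p, B p -> sim E p (w p) /\ ~ V (w p).
  exact: (@choice_on _ _ p0 B (fun p p' => sim E p p' /\ ~ V p')).
(* Near [p0] the point [p] itself lies in [V], so the escaping point [w p] differs from [p] and must
   be reached by a path. *)
have joinG : \forall p \near G, [/\ p.1 = (w p).1,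
    path_joined (R := R) (crit E (set_val p.1)) p.2 (w p).2 & ~ V (w p)].
  apply: filterS2 GB GV => p Bp Vp; have [/simR[ppw|[h1 h2]] nVw] := wP p Bp => //.
  by rewrite -ppw in nVw.
pose t := set_val p0.1; pose x := p0.2.
have tt : set_val p.1 @[p --> G] --> t.
  exact: (cvg_comp _ _ Gp0 (@time_continuous p0)).
have xx : p.2 @[p --> G] --> x by exact: (cvg_comp _ _ Gp0 cvg_snd).
have t01 : t \in `[0, T] by exact: timeP.
have G01 : \forall p \near G, set_val p.1 \in `[0, T].
  by apply: filterE => p; exact: timeP.
have cx : crit E t x.
  apply: (crit_cvg hA2 t01 G01 tt xx); apply: filterS joinG => p [_ + _].
  by move=> jp; have [] := path_joined_crit jp.
have [f [cf f0 f1]] := component_separator t01 cx.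
have [K cK KP] := sublevels_compact hA2 hA3 hA4 (E t x + 1).
have Elt : \forall p \near G, E (set_val p.1) p.2 <= E t x + 1.
  have Ecvg : E (set_val p.1) p.2 @[p --> G] --> E t x.
    exact: (@energy_cvg _ _ _ _ hA2 _ G _ _ _ _ _ t01 G01 tt xx).
  by apply: (cvgr_le _ Ecvg); rewrite ltrDl.
(* The energy is constant along each component, so every point joined to [p] has the energy of [p]
   and stays in the compact set [K]. *)
have inK (u : timeI T * X -> X) :
    (\forall p \near G, path_joined (R := R) (crit E (set_val p.1)) p.2 (u p)) ->
    exists2 y, crit E t y & u p @[p --> G] --> y.
  move=> ju; have [|y _ uy] := ultra_cvg_compact GU cK (f := u).
    near=> p; apply: (KP (set_val p.1)); first exact: timeP.
    have jp : path_joined (R := R) (crit E (set_val p.1)) p.2 (u p) by near: p.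
    by have [_ /(_ _ _ jp) <-] := hA5 (timeP p.1); near: p.
  exists y => //; apply: (crit_cvg hA2 t01 G01 tt uy); apply: filterS ju => p.
  by move=> jp; have [] := path_joined_crit jp.
have [|x' cx' wx'] := inK (fun p => (w p).2).
  by apply: filterS joinG => p [].
have nxx' : ~ path_joined (R := R) (crit E t) x x'.
  move=> jxx'; have : V (p0.1, x') by apply: Vp0; apply/simR; right.
  have nVx' : (~` V) (p0.1, x').
    apply: (@closed_cvg _ _ G _ (fun p => (p.1, (w p).2)) (~` V)).
    - exact: open_closedC.
    - by apply: filterS joinG => p [-> _]; rewrite -surjective_pairing.
    - have fstG : p.1 @[p --> G] --> p0.1 by exact: (cvg_comp _ _ Gp0 cvg_fst).
      exact: cvg_pair fstG wx'.
  by [].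
have fp0 : f p.2 @[p --> G] --> (0 : R).
  have fx0 : f x = 0 by apply: f0; exact: path_joined_refl.
  by rewrite -[X in _ --> X]fx0; exact: (cvg_comp _ _ xx (cf x)).
have fp1 : f (w p).2 @[p --> G] --> (1 : R).
  by rewrite -[X in _ --> X](f1 x')//; exact: (cvg_comp _ _ wx' (cf x')).
have exu : \forall p \near G, exists u,
    path_joined (R := R) (crit E (set_val p.1)) p.2 u /\ f u = 2^-1.
  have [h0 h1] := andP half01.
  near=> p; have [_ jp _] : [/\ p.1 = (w p).1,
    path_joined (R := R) (crit E (set_val p.1)) p.2 (w p).2 & ~ V (w p)] by near: p.
  have [|u ju fu] := path_joined_ivt (v := 2^-1) cf jp; last by exists u.
  apply/andP; split; near: p.
    by apply: (cvgr_le _ fp0).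
  by apply: (cvgr_ge _ fp1).
have [u uP] : exists u : timeI T * X -> X, \forall p \near G,
    path_joined (R := R) (crit E (set_val p.1)) p.2 (u p) /\ f (u p) = 2^-1.
  have [u uP] := @choice_on _ _ x _ (fun (p : timeI T * X) v =>
    path_joined (R := R) (crit E (set_val p.1)) p.2 v /\ f v = 2^-1)
    (fun _ h => h).
  by exists u; exact: filterS exu.
have [|y cy uy] := inK u; first by apply: filterS uP => p [].
have fuy : f (u p) @[p --> G] --> f y by exact: (cvg_comp _ _ uy (cf y)).
have fu2 : f (u p) @[p --> G] --> (2^-1 : R).
  by apply: cvg_near_cst; apply: filterS uP => p [].
have fy : f y = 2^-1 by exact: cvg_unique fuy fu2.
have [jy|njy] := pselect (path_joined (R := R) (crit E t) x y).
  by move: half01; rewrite -fy f0// ltxx.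
by move: half01; rewrite -fy f1// ltxx andbF.
Unshelve. all: by end_near. Qed.

Lemma qmap_continuous : continuous (fun p : timeI T * X => qmap E p.1 p.2).
Proof.
have -> : (fun p : timeI T * X => qmap E p.1 p.2) = \pi_(qspace T E)%qT.
  by apply/funext => -[].
exact: (@pi_continuous _ (qspace T E)).
Qed.

Lemma qspace_ind (P : qspace T E -> Prop) :
  (forall t x, P (qmap E t x)) -> forall z, P z.
Proof. by move=> h z; rewrite -[z]reprK; case: (repr z) => t x; exact: h. Qed.

Lemma qenergy_continuous : continuous (@qenergy R T X E).
Proof.
apply/(@quotient_continuous _ (qspace T E)).
have -> : @qenergy R T X E \o \pi_(qspace T E)%qT =
    (fun p : timeI T * X => E (set_val p.1) p.2).
  by apply/funext => -[t x] /=; rewrite -/(qmap E t x) qenergy_qmap.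
move=> p; apply: (@energy_cvg _ _ _ _ hA2 _ (nbhs p) _ _ _ _ _ (timeP p.1)).
- by apply: filterE => r; exact: timeP.
- exact: time_continuous.
- exact: cvg_snd.
Qed.

Lemma slope_continuous :
  continuous (fun p : timeI T * X => fine (slope (E (set_val p.1)) p.2)).
Proof.
move=> p; apply: (@slope_cvg _ _ _ _ hA2 _ (nbhs p) _ _ _ _ _ (timeP p.1)).
- by apply: filterE => r; exact: timeP.
- exact: time_continuous.
- exact: cvg_snd.
Qed.

(** It is enough to find a continuous function on the product that takes one value on the first
    class and another on the second: [core] keeps the classes lying entirely inside an open set, and
    upper semicontinuity makes it open. The function is the time if the times differ, a component
    separator for two critical classes, the slope if exactly one of them is critical, and the
    projection to [X] for two noncritical points, whose classes are singletons. *)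
Lemma qspace_hausdorff : hausdorff_space (qspace T E).
Proof.
pose core (V : set (timeI T * X)) : set (qspace T E) :=
  [set w | forall p, qmap E p.1 p.2 = w -> V p].
have core_open V : open V -> open (core V).
  move=> oV; rewrite /open /= /quotient_open openE => p coreVp.
  have h p' : sim E p p' -> V p'.
    move=> pp'; apply: coreVp; apply/esym; case: p p' pp' => t x [s y] /= ?.
    exact/qmapP.
  apply: filterS (class_upper_semicontinuous oV h) => r hr p' pr.
  apply: hr; case: r p' pr => t x [s y] /= /esym /qmapP; exact.
have separate (Z : topologicalType) (phi : timeI T * X -> Z) (a b : Z)
    (p1 p2 : timeI T * X) : hausdorff_space Z -> continuous phi -> a != b ->
    (forall p, sim E p1 p -> phi p = a) -> (forall p, sim E p2 p -> phi p = b) ->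
    exists2 AB, (qmap E p1.1 p1.2 \in AB.1 /\ qmap E p2.1 p2.2 \in AB.2) &
      [/\ open AB.1, open AB.2 & AB.1 `&` AB.2 == set0].
  rewrite open_hausdorff => hZ cphi ab phia phib.
  have [[A B] /= [Aa Bb] [oA oB AB0]] := hZ a b ab.
  move/continuousP : cphi => cphi.
  exists (core (phi @^-1` A), core (phi @^-1` B)) => /=.
    split; apply/mem_set => -[t x] /= /esym/qmapP; rewrite -surjective_pairing.
      by move=> /phia ->; exact/set_mem.
    by move=> /phib ->; exact/set_mem.
  split; [exact: core_open (cphi _ oA)|exact: core_open (cphi _ oB)|].
  apply/eqP; rewrite -subset0 => w; elim/qspace_ind: w => t x [h1 h2].
  have : (A `&` B) (phi (t, x)) by split; [exact: h1|exact: h2].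
  by rewrite (eqP AB0).
rewrite open_hausdorff => z1 z2.
elim/qspace_ind: z1 => t1 x1; elim/qspace_ind: z2 => t2 x2 z12.
pose S (p : timeI T * X) : R := fine (slope (E (set_val p.1)) p.2).
have S0 (p : timeI T * X) : S p = 0 <-> crit E (set_val p.1) p.2.
  have [_ _ _ fin _] := hA2; rewrite /crit/= /S; split=> [h|->//].
  by rewrite -(fineK (fin _ p.2 (timeP p.1))) h.
have R_hausdorff : hausdorff_space R by exact: norm_hausdorff.
have [t12|t12] := eqVneq (set_val t1 : R) (set_val t2); last first.
  apply: (separate R (fun p => set_val p.1) _ _ (t1, x1) (t2, x2)) t12 _ _ => //.
  - exact: time_continuous.
  - by move=> p /simR[<-//|[/= <-]].
  - by move=> p /simR[<-//|[/= <-]].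
have {}t12 : t1 = t2 by exact: val_inj.
subst t2; pose t := t1.
have sim_crit x p : crit E (set_val t) x -> sim E (t, x) p ->
    p.1 = t /\ path_joined (R := R) (crit E (set_val t)) x p.2.
  move=> cx /simR[<-|[]//=]; split=> //=; exact: path_joined_refl.
have sim_ncrit x p : ~ crit E (set_val t) x -> sim E (t, x) p -> p = (t, x).
  by move=> ncx /simR[//|[_ /=]] jx; have [] := path_joined_crit jx.
have [c1|nc1] := pselect (crit E (set_val t) x1);
  have [c2|nc2] := pselect (crit E (set_val t) x2).
- have [f [cf f0 f1]] := component_separator (timeP t) c1.
  apply: (separate R (f \o snd) 0 1 (t, x1) (t, x2)) => //.
  + by move=> p; apply: continuous_comp; [exact: cvg_snd|exact: cf].
  + by rewrite eq_sym oner_neq0.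
  + by move=> p /(sim_crit _ _ c1)[_ ?]; exact: f0.
  + move=> p /(sim_crit _ _ c2)[_ jx2]; apply: f1.
      by have [] := path_joined_crit jx2.
    move=> jx1; move/eqP: z12; apply; apply/qmapP/simR; right; split=> //=.
    by apply: path_joined_trans jx1 _; exact: path_joined_sym.
- apply: (separate R S 0 (S (t, x2)) (t, x1) (t, x2)) => //.
  + exact: slope_continuous.
  + by apply/negP => /eqP/esym/S0.
  + move=> p /(sim_crit _ _ c1)[pt jx]; apply/S0; rewrite pt.
    by have [] := path_joined_crit jx.
  + by move=> p /(sim_ncrit _ _ nc2) ->.
- apply: (separate R S (S (t, x1)) 0 (t, x1) (t, x2)) => //.
  + exact: slope_continuous.
  + by apply/negP => /eqP/S0.
  + by move=> p /(sim_ncrit _ _ nc1) ->.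
  + move=> p /(sim_crit _ _ c2)[pt jx]; apply/S0; rewrite pt.
    by have [] := path_joined_crit jx.
- apply: (separate X snd x1 x2 (t, x1) (t, x2)) => //.
  + exact: metric_hausdorff.
  + by move=> p; exact: cvg_snd.
  + by apply: contra z12 => /eqP ->.
  + by move=> p /(sim_ncrit _ _ nc1) ->.
  + by move=> p /(sim_ncrit _ _ nc2) ->.
Qed.

End quotient_hausdorff.

Lemma integrable_setU d (T : measurableType d) (R : realType)
    (mu : {measure set T -> \bar R}) (A B : set T) (f : T -> \bar R) :
  measurable A -> measurable B -> [disjoint A & B] ->
  mu.-integrable A f -> mu.-integrable B f -> mu.-integrable (A `|` B) f.
Proof.
move=> mA mB AB /integrableP[mfA fA] /integrableP[mfB fB].
have mfU := (measurable_funU _ mA mB).2 (conj mfA mfB).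
apply/integrableP; split=> //; rewrite ge0_integral_setU//.
- exact: lte_add_pinfty.
- exact: measurableT_comp.
Qed.

(** * Energy balance *)

Section power_integral.
Context {R : realType} {X : metricType R} (T : R) (E : R -> X -> R).
Hypothesis hA2 : energy_regular T E.

Lemma partial_t_integrable (x : X) (a b : R) : 0 <= a -> b <= T ->
  (@lebesgue_measure R).-integrable `[a, b] (EFin \o (partial_t T E ^~ x)).
Proof.
move=> a0 bT; apply: continuous_compact_integrable; first exact: segment_compact.
apply: continuous_subspaceW (partial_t_continuous hA2 (x := x)).
by apply: subset_itv; rewrite bnd_simp.
Qed.

Lemma partial_t_integral (x : X) (a b : R) : 0 <= a -> a <= b -> b <= T ->
  \int[@lebesgue_measure R]_(t in `[a, b]) partial_t T E t x = E b x - E a x.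
Proof.
move=> a0; rewrite le_eqVlt => /predU1P[<- _|ab bT].
  by rewrite set_itv1 Rintegral_set1 subrr.
have sub : `[a, b] `<=` `[0, T] by apply: subset_itv; rewrite bnd_simp.
have cE : {within `[a, b], continuous (E ^~ x)}.
  exact: continuous_subspaceW sub (energy_continuous hA2 (x := x)).
have oo r : r \in `]a, b[ -> r \in `]0, T[.
  by rewrite !in_itv/= => /andP[ar rb]; rewrite (le_lt_trans a0)// (lt_le_trans rb).
rewrite /Rintegral (@continuous_FTC2 _ _ (E ^~ x))//.
- exact: continuous_subspaceW sub (partial_t_continuous hA2 (x := x)).
- have /(continuous_within_itvP _ ab)[_ ca cb] := cE; split=> // r /oo rI.
  by have [] := energy_is_derive hA2 x rI.
- by move=> r /oo rI; rewrite derive1E; have [_ ->] := energy_is_derive hA2 x rI.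
Qed.

End power_integral.

Section energy_balance.
Context {R : realType} {X : metricType R} (T : R) (E : R -> X -> R).
Hypotheses (T_gt0 : 0 < T) (hA2 : energy_regular T E).
Variables (omega : R -> X -> X) (x0 : X) (d : R).
Hypothesis d_gt0 : 0 < d.

Let M := nsteps T d.
Let w := qs_step omega x0 d.

Lemma evolution_step (i : nat) (t : R) : (i <= M)%N -> i%:R * d <= t ->
  (t < i.+1%:R * d \/ i = M) -> evolution T omega x0 d t = w i.
Proof.
by move=> iM it ti; rewrite /evolution -/(step_index T d t) (step_index_eq d_gt0 iM it ti).
Qed.

Lemma energy_dropE (i : nat) : (i < M)%N ->
  energy_drop T E omega x0 d (i.+1%:R * d) =
  E (i.+1%:R * d) (w i) - E (i.+1%:R * d) (w i.+1).
Proof.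
move=> iM; set t := i.+1%:R * d.
have t01 : t \in `[0, T] by exact: step_time.
have tT : t < T.
  by apply: le_lt_trans (nsteps_lt T_gt0 d_gt0); rewrite ler_pM2r// ler_nat.
have it : i%:R * d < t by rewrite ltr_pM2r// ltr_nat.
have ti : t < i.+2%:R * d by rewrite ltr_pM2r// ltr_nat.
have i0 : 0 <= i%:R * d by rewrite mulr_ge0// ltW.
have cl : energy_along T E omega x0 d s @[s --> t^'-] --> E t (w i).
  have c : E s (w i) @[s --> t^'-] --> E t (w i).
    apply: (energy_cvg hA2 t01); last exact: cvg_cst.
    - near=> s; rewrite in_itv/=; apply/andP; split; last first.
        by apply: le_trans (ltW tT); near: s; exact: nbhs_left_le.
      by apply: le_trans i0 _; near: s; exact: nbhs_left_ge.
    - exact: cvg_within.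
  apply: cvg_trans c; apply: near_eq_cvg; near=> s.
  rewrite /energy_along (@evolution_step i)//; first exact: ltnW.
    by near: s; exact: nbhs_left_ge.
  by left; near: s; exact: nbhs_left_lt.
have cr : energy_along T E omega x0 d s @[s --> t^'+] --> E t (w i.+1).
  have c : E s (w i.+1) @[s --> t^'+] --> E t (w i.+1).
    apply: (energy_cvg hA2 t01); last exact: cvg_cst.
    - near=> s; rewrite in_itv/=; apply/andP; split; last first.
        by near: s; exact: nbhs_right_le.
      by apply: le_trans (le_trans i0 (ltW it)) _; near: s; exact: nbhs_right_ge.
    - exact: cvg_within.
  apply: cvg_trans c; apply: near_eq_cvg; near=> s.
  rewrite /energy_along (@evolution_step i.+1)//.
  by left; near: s; exact: nbhs_right_lt.
by rewrite /energy_drop (cvg_lim _ cl)// (cvg_lim _ cr).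
Unshelve. all: by end_near. Qed.

Lemma energy_drop_ge0 (i : nat) : energy_decreasing_rule T E omega ->
  (i < M)%N -> 0 <= energy_drop T E omega x0 d (i.+1%:R * d).
Proof.
move=> hAx1 iM; rewrite energy_dropE// subr_ge0; apply: hAx1.
exact: step_time.
Qed.

Let power := power_along T E omega x0 d.

(** The fundamental theorem of calculus applies on each step, where the state is frozen, and the
    energies telescope up to the drops. The conclusion uses [w i] rather than the state at [t], so
    that the induction may stop at [t = i.+1 * d], just before the next update acts. *)
Lemma power_integral (i : nat) : (i <= M)%N ->
  forall t, i%:R * d <= t -> t <= i.+1%:R * d -> t <= T ->
  (@lebesgue_measure R).-integrable `[0, t[ (EFin \o power) /\
  \int[@lebesgue_measure R]_(r in `[0, t[) power r =
  E t (w i) - E 0 x0 + \sum_(1 <= j < i.+1) energy_drop T E omega x0 d (j%:R * d).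
Proof.
have piece j t : (j <= M)%N -> j%:R * d <= t -> t <= j.+1%:R * d -> t <= T ->
    (@lebesgue_measure R).-integrable `[j%:R * d, t[ (EFin \o power) /\
    \int[@lebesgue_measure R]_(r in `[j%:R * d, t[) power r =
    E t (w j) - E (j%:R * d) (w j).
  move=> jM jt tj tT; have j0 : 0 <= j%:R * d by rewrite mulr_ge0// ltW.
  have eqp : {in `[j%:R * d, t[%classic, power =1 (partial_t T E ^~ (w j))}.
    move=> r /set_mem /=; rewrite in_itv/= => /andP[jr rt].
    rewrite /power /power_along (@evolution_step j)//.
    by left; exact: lt_le_trans tj.
  have ip : (@lebesgue_measure R).-integrable `[j%:R * d, t[
      (EFin \o (partial_t T E ^~ (w j))).
    apply: integrableS (partial_t_integrable hA2 (w j) j0 tT) => //.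
    exact: subset_itv_co_cc.
  split.
    apply: eq_integrable ip => //.
    by move=> r rI; rewrite /= eqp.
  transitivity (\int[@lebesgue_measure R]_(r in `[j%:R * d, t[) partial_t T E r (w j)).
    by apply: eq_Rintegral => r; exact: eqp.
  by rewrite Rintegral_itv_bndo_bndc// partial_t_integral.
elim: i => [_ t t0 t1 tT|i IH iM t it ti tT].
  have := piece 0%N t (leq0n _) t0 t1 tT.
  by rewrite !mul0r => -[i0 ->]; split=> //; rewrite big_geq// addr0.
have it1 : i%:R * d <= i.+1%:R * d by rewrite ler_pM2r// ler_nat.
have [int1 eq1] := IH (ltnW iM) _ it1 (lexx _) (le_trans it tT).
have [int2 eq2] := piece i.+1 t iM it ti tT.
have i0 : 0 <= i.+1%:R * d by rewrite mulr_ge0// ltW.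
have cup : `[0, t[%classic =
    `[0, i.+1%:R * d[%classic `|` `[i.+1%:R * d, t[%classic :> set R.
  by apply: itv_bndbnd_setU; rewrite bnd_simp.
have disj : [disjoint `[0, i.+1%:R * d[%classic & (`[i.+1%:R * d, t[%classic : set R)].
  apply/disj_setPS => r /= [].
  by rewrite !in_itv/= => /andP[_ r1] /andP[r2 _]; move: r1; rewrite ltNge r2.
have int12 : (@lebesgue_measure R).-integrable
    (`[0, i.+1%:R * d[%classic `|` `[i.+1%:R * d, t[%classic) (EFin \o power).
  by apply: integrable_setU.
rewrite cup; split=> //.
by rewrite Rintegral_setU// eq1 eq2 [in RHS]big_nat_recr//= energy_dropE// -/w; ring.
Qed.

(* The measure of [0, t] for [mu_step]. *)
Definition dissipation (t : R) : R :=
  \sum_(1 <= j < M.+1 | j%:R * d <= t) energy_drop T E omega x0 d (j%:R * d).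

(** The work of the power up to [t] is written as a pairing with an indicator over [0,T], the form
    in which weak-* convergence applies. *)
Lemma dissipation_balance (t : R) : t \in `[0, T] ->
  dissipation t = E 0 x0 - energy_along T E omega x0 d t +
  \int[@lebesgue_measure R]_(r in `[0, T]) (power r * \1_`[0, t] r).
Proof.
move=> t01; have /andP[t0 tT] : 0 <= t <= T by move: t01; rewrite in_itv.
have /andP[it ti] := step_index_itv T_gt0 d_gt0 t01.
have iM : (step_index T d t <= M)%N by exact: geq_minl.
have [ipow eqpow] := power_integral iM it ti tT.
have -> : \int[@lebesgue_measure R]_(r in `[0, T]) (power r * \1_`[0, t] r) =
    \int[@lebesgue_measure R]_(r in `[0, t[) power r.
  rewrite Rintegral_itv_bndo_bndc//.
  have sub : `[0, t]%classic = `[0, T]%classic `&` `[0, t]%classic :> set R.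
    by apply/esym/setIidr; apply: subset_itvl; rewrite bnd_simp.
  rewrite [in RHS]sub Rintegral_mkcondr; apply: eq_Rintegral => r _.
  by rewrite patchE indicE; case: ifPn => _; rewrite ?mulr1 ?mulr0.
rewrite eqpow /energy_along /evolution -/(step_index T d t) -/w.
have -> : dissipation t =
    \sum_(1 <= j < (step_index T d t).+1) energy_drop T E omega x0 d (j%:R * d).
  rewrite (big_nat_widen _ _ M.+1)//= /dissipation big_mkcond [RHS]big_mkcond/=.
  apply: eq_big_nat => j /andP[_ jM].
  have -> // : (j%:R * d <= t) = (j < (step_index T d t).+1)%N.
  rewrite ltnS /step_index leq_min -ltnS jM/= truncn_ge_nat ?ler_pdivlMr//.
  by rewrite mul0r.
by ring.
Qed.

(** On [0,T] [phi] lies between the indicators of [[0, a]] and [[0, b]]; Axiom 1 makes the drops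
    nonnegative, so this order survives summation. *)
Lemma dissipation_le_integral (phi : R -> R) (a b : R) :
  energy_decreasing_rule T E omega ->
  (forall r, r \in `[0, T] -> 0 <= phi r <= 1) ->
  (forall r, r \in `[0, T] -> r <= a -> phi r = 1) ->
  (forall r, r \in `[0, T] -> b < r -> phi r = 0) ->
  dissipation a <= mu_step_integral T E omega x0 d phi <= dissipation b.
Proof.
move=> hAx1 phi01 phi1 phi0; rewrite /dissipation /mu_step_integral.
rewrite !(big_mkcond (fun j : nat => j%:R * d <= _)).
have bnd (j : nat) : (0 < j < M.+1)%N ->
    j%:R * d \in `[0, T] /\ 0 <= energy_drop T E omega x0 d (j%:R * d).
  case: j => [//|j] /= jM; split; first exact: step_time.
  exact: energy_drop_ge0.
apply/andP; split; apply: ler_sum_nat => j /bnd[jI drop0].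
- case: ifPn => [ja|_]; first by rewrite phi1// mul1r.
  by rewrite mulr_ge0//; have /andP[] := phi01 _ jI.
- case: ifPn => [_|]; last by rewrite -ltNge => bj; rewrite phi0// mul0r.
  by rewrite ler_piMl//; have /andP[] := phi01 _ jI.
Qed.

End energy_balance.

(** * Distribution function and atoms of a finite measure *)

Section cumulative_measure.
Context {R : realType} (mu : {finite_measure set (measurableTypeR R) -> \bar R}).

Let fmu (A : set R) := fine (mu A).

Lemma fine_measure_le (A B : set R) : measurable A -> measurable B ->
  A `<=` B -> fmu A <= fmu B.
Proof.
move=> mA mB AB; rewrite /fmu fine_le ?fin_num_measure//.
by apply: le_measure => //; rewrite inE.
Qed.

(** Continuity from above along shrinking closed intervals. The parameter [c] serves to keep [b]
    inside [0,T]: it is later taken to be [T - t]. *)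
Lemma measure_itv_right (t c e : R) : 0 <= t -> 0 < c -> 0 < e ->
  exists2 b, t < b <= t + c & fmu `[0, b] <= fmu `[0, t] + e.
Proof.
move=> t0 c0 e0; pose F (n : nat) : set R := `[0, t + c * n.+1%:R^-1]%classic.
have capF : \bigcap_n F n = `[0, t]%classic.
  apply/seteqP; split=> r; last first.
    rewrite /= in_itv/= => /andP[r0 rt] n _; rewrite /F /= in_itv/= r0/=.
    by rewrite (le_trans rt)// lerDl mulr_ge0// ltW.
  move=> h; have := h 0%N I; rewrite /F /= !in_itv/= => /andP[-> _] /=.
  apply/ler_addgt0Pr => x x0.
  have xc : 0 < x / c by rewrite divr_gt0.
  near \oo => n; have := h n I; rewrite /F /= in_itv/= => /andP[_ /le_trans]; apply.
  rewrite lerD2l -ler_pdivlMl// mulrC; apply: ltW.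
  by near: n; exact: near_infty_natSinv_lt (PosNum xc).
have : mu \o F @ \oo --> mu (\bigcap_n F n).
  apply: nonincreasing_cvg_mu.
  - by rewrite ltey_eq fin_num_measure//; exact: measurable_itv.
  - by move=> n; exact: measurable_itv.
  - by rewrite capF; exact: measurable_itv.
  - move=> m n mn; apply/subsetPset; apply: subset_itvl; rewrite bnd_simp lerD2l.
    by rewrite ler_pM2l// lef_pV2 ?posrE// ler_nat.
rewrite capF -[X in _ --> X]fineK ?fin_num_measure// => /fine_cvg cF.
have [n nP] : exists n, fmu (F n) <= fmu `[0, t] + e.
  near \oo => n; exists n; near: n.
  by apply: (cvgr_le _ cF); rewrite ltrDl.
exists (t + c * n.+1%:R^-1) => //.
rewrite ltrDl mulr_gt0//= lerD2l ler_piMr ?(ltW c0)//.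
by rewrite invf_le1// ler1n.
Unshelve. all: by end_near. Qed.

Lemma measure_itv_left (t e : R) : 0 < t -> 0 < e ->
  exists2 a, 0 <= a < t & fmu `[0, t[ - e <= fmu `[0, a].
Proof.
move=> t0 e0; pose F (n : nat) : set R := `[0, t - t * n.+1%:R^-1]%classic.
have tn (n : nat) : 0 < t * n.+1%:R^-1 by rewrite mulr_gt0.
have cupF : \bigcup_n F n = `[0, t[%classic.
  apply/seteqP; split=> r.
    move=> [n _]; rewrite /F /= !in_itv/= => /andP[-> /le_lt_trans -> //].
    by rewrite gtrBl.
  rewrite /= in_itv/= => /andP[r0 rt].
  have x0 : 0 < (t - r) / t by rewrite divr_gt0// subr_gt0.
  near \oo => n; exists n => //; rewrite /F /= in_itv/= r0/=.
  rewrite lerBrDr -lerBrDl -ler_pdivlMl// mulrC; apply: ltW.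
  by near: n; exact: near_infty_natSinv_lt (PosNum x0).
have : mu \o F @ \oo --> mu (\bigcup_n F n).
  apply: nondecreasing_cvg_mu.
  - by move=> n; exact: measurable_itv.
  - by rewrite cupF; exact: measurable_itv.
  - move=> m n mn; apply/subsetPset; apply: subset_itvl; rewrite bnd_simp lerD2l lerN2.
    by rewrite ler_pM2l// lef_pV2 ?posrE// ler_nat.
rewrite cupF -[X in _ --> X]fineK ?fin_num_measure// => /fine_cvg cF.
have [n nP] : exists n, fmu `[0, t[ - e <= fmu (F n).
  near \oo => n; exists n; near: n.
  by apply: (cvgr_ge _ cF); rewrite gtrBl.
exists (t - t * n.+1%:R^-1) => //.
rewrite gtrBl tn andbT subr_ge0 ler_piMr ?(ltW t0)//.
by rewrite invf_le1// ler1n.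
Unshelve. all: by end_near. Qed.

Lemma measure_atoms_countable : countable [set r : R | mu [set r] <> 0%E].
Proof.
have mu1 (r : R) : mu [set r] \is a fin_num by rewrite fin_num_measure.
have -> : [set r : R | mu [set r] <> 0%E] =
    \bigcup_n [set r | n.+1%:R^-1 < fmu [set r]].
  apply/seteqP; split=> r /=.
    move=> nz; have r0 : 0 < fmu [set r].
      by rewrite fine_gt0// ltey_eq mu1 andbT lt0e measure_ge0 andbT; exact/eqP.
    near \oo => n; exists n => //=.
    by near: n; exact: near_infty_natSinv_lt (PosNum r0).
  move=> [n _ /= nr] mu0; move: nr; rewrite /fmu mu0 /= ltNge => /negP; apply.
  by rewrite invr_ge0.
apply: bigcup_countable => // n _; apply: finite_set_countable.
apply: contrapT => /infiniteP/pcard_leP/injfunPex[/= q qn qinj].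
(* With this many atoms of mass above [1 / n.+1], the total mass would be at least its integer part
   plus one. *)
pose N := (n.+1 * (Num.truncn (fmu setT)).+1)%N.
have mq i : measurable ([set q i] : set R) by exact: measurable_set1.
have le1 : \sum_(i < N) fmu [set q i] <= fmu setT.
  have -> : \sum_(i < N) fmu [set q i] = fmu (\big[setU/set0]_(i < N) [set q i]).
    rewrite /fmu measure_semi_additive_ord//=.
    - by rewrite -EFin_sum_fine// => i _; exact: mu1.
    - move=> i j _ _ [x [/= -> qij]]; apply/val_inj/qinj => //; exact: mem_setT.
    - by apply: bigsetU_measurable => i _; exact: mq.
  by apply: fine_measure_le => //; apply: bigsetU_measurable => i _; exact: mq.
have : N%:R / n.+1%:R <= fmu setT.
  apply: le_trans le1; rewrite mulr_natl -[X in _ *+ X]card_ord -sumr_const.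
  by apply: ler_sum => i _; apply/ltW; exact: qn.
have fmu0 : 0 <= fmu setT by rewrite fine_ge0.
rewrite leNgt => /negP; apply.
rewrite /N mulnC natrM mulfK ?pnatr_eq0//.
by have /andP[] := truncn_itv fmu0.
Unshelve. all: by end_near. Qed.

End cumulative_measure.

(** * Passage to the limit in the energy balance *)

Section limit_balance.
Context {R : realType} {X : metricType R} (T : R) (E : R -> X -> R).
Hypotheses (T_gt0 : 0 < T) (hA2 : energy_regular T E).
Variables (delta : nat -> R) (omega : R -> X -> X) (x0 : X).
Hypothesis delta_gt0 : forall n, 0 < delta n.
Variables (mu : {finite_measure set (measurableTypeR R) -> \bar R}).
Variables (Ebar D : R -> R).
Hypothesis hC : qs_convergence T E omega x0 delta mu Ebar D.
Hypothesis hAx1 : energy_decreasing_rule T E omega.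

Let fmu (A : set R) := fine (mu A).

Lemma limit_power_integrable : (@lebesgue_measure R).-integrable `[0, T] (EFin \o D).
Proof.
have [[_ _ [mD [M DM]]] _ _ _] := hC.
have mE : measurable_fun `[0, T] (EFin \o D) by exact/measurable_EFinP.
apply/integrableP; split=> //.
apply: (@le_lt_trans _ _ (\int[@lebesgue_measure R]_(r in `[0%R, T]) (`|M|%R)%:E)%E).
  apply: ae_ge0_le_integral => //.
  - exact: measurableT_comp.
  - have aeF := ae_filter_ringOfSetsType (@lebesgue_measure R).
    apply: (@filterS _ _ aeF) DM => r h rI; rewrite lee_fin.
    by apply: le_trans (h rI) _; exact: ler_norm.
rewrite integral_cst//= lebesgue_measure_itv/= lte_fin T_gt0.
by rewrite -EFinB -EFinM ltry.
Qed.

Let powerI (t : R) := \int[@lebesgue_measure R]_(r in `[0, t]) D r.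

Let powerI_continuous : {within `[0, T], continuous powerI}.
Proof.
exact: parameterized_integral_continuous (ltW T_gt0) limit_power_integrable.
Qed.

Let F (t : R) := E 0 x0 - Ebar t + powerI t.

Let dissipation_cvg (t : R) : t \in `[0, T] ->
  dissipation T E omega x0 (delta n) t @[n --> \oo] --> F t.
Proof.
move=> t01; have /andP[t0 tT] : 0 <= t <= T by move: t01; rewrite in_itv.
have [_ _ cE cD] := hC.
under eq_cvg do rewrite (dissipation_balance T_gt0 hA2 omega x0 (delta_gt0 _) t01).
apply: cvgD; first by apply: cvgB; [exact: cvg_cst|exact: cE].
have -> : powerI t = \int[@lebesgue_measure R]_(r in `[0, T]) (D r * \1_`[0, t] r).
  have sub : `[0, t]%classic = `[0, T]%classic `&` `[0, t]%classic :> set R.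
    by apply/esym/setIidr; apply: subset_itvl; rewrite bnd_simp.
  rewrite /powerI [in LHS]sub Rintegral_mkcondr; apply: eq_Rintegral => r _.
  by rewrite patchE indicE; case: ifPn => _; rewrite ?mulr1 ?mulr0.
apply: cD; apply: integrableS (integrable_indic_itv 0 t true false) => //.
Qed.

(** The integral of [phi] against [mu] is caught twice: between [F a] and [F b], as the limit of the
    discrete inequalities, and between the masses of [[0, a]] and [[0, b]], by comparison with
    indicators. *)
Let sandwich (phi : R -> R) (a b : R) : a \in `[0, T] -> b \in `[0, T] ->
  continuous phi ->
  (forall r, r \in `[0, T] -> 0 <= phi r <= 1) ->
  (forall r, r \in `[0, T] -> r <= a -> phi r = 1) ->
  (forall r, r \in `[0, T] -> b < r -> phi r = 0) ->
  F a <= fmu `[0, b] /\ fmu `[0, a] <= F b.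
Proof.
move=> a01 b01 cphi phi01 phi1 phi0.
have [_ cmu _ _] := hC.
have {}cmu := cmu phi (continuous_subspaceT cphi).
have le n := dissipation_le_integral T_gt0 hA2 x0 (delta_gt0 n) hAx1 phi01 phi1 phi0.
have Fa : F a <= \int[mu]_(t in `[0, T]) phi t.
  apply: (ler_cvg_to (dissipation_cvg a01) cmu).
  by apply: filterE => n; have /andP[] := le n.
have Fb : \int[mu]_(t in `[0, T]) phi t <= F b.
  apply: (ler_cvg_to cmu (dissipation_cvg b01)).
  by apply: filterE => n; have /andP[] := le n.
have mI (x y : R) : measurable `[x, y]%classic by exact: measurable_itv.
have muI (A : set R) : measurable A -> (mu A < +oo)%E.
  by move=> mA; rewrite ltey_eq fin_num_measure.
have iphi : mu.-integrable `[0, T] (EFin \o phi).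
  apply: measurable_bounded_integrable => //; first exact: muI.
    by apply: measurable_funTS; exact: continuous_measurable_fun.
  exists 1; split=> // x x1 r /= rI; rewrite ger0_norm; last first.
    by have /andP[] := phi01 r rI.
  by apply: le_trans (ltW x1); have /andP[] := phi01 r rI.
have iindic c : mu.-integrable `[0, T] (EFin \o \1_`[0, c]).
  apply: measurable_bounded_integrable => //; first exact: muI.
  exists 1; split=> // x x1 r /= rI; rewrite indicE ger0_norm//.
  by apply: le_trans (ltW x1); case: (r \in _).
have eindic c : c \in `[0, T] -> \int[mu]_(t in `[0, T]) \1_`[0, c] t = fmu `[0, c].
  rewrite in_itv/= => /andP[c0 cT].
  have sub : `[0, c]%classic = `[0, T]%classic `&` `[0, c]%classic :> set R.
    by apply/esym/setIidr; apply: subset_itvl; rewrite bnd_simp.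
  rewrite /fmu [in RHS]sub -[RHS]mul1r -Rintegral_cst//; last exact: measurableI.
  rewrite Rintegral_mkcondr; apply: eq_Rintegral => r _.
  by rewrite patchE indicE; case: ifPn.
split.
- apply: le_trans Fa _; rewrite -eindic//; apply: le_Rintegral => // r rI.
  rewrite indicE; have [br|br] := ltP b r; first by rewrite phi0.
  rewrite mem_set/=; first by have /andP[] := phi01 r rI.
  by move: rI; rewrite /= !in_itv/= br andbT => /andP[].
- apply: le_trans Fb; rewrite -eindic//; apply: le_Rintegral => // r rI.
  rewrite indicE; have [ra|ar] := leP r a; first by rewrite phi1//; case: (r \in _).
  rewrite memNset/=; first by have /andP[] := phi01 r rI.
  by rewrite /= in_itv/= => /andP[_]; rewrite leNgt ar.
Qed.

Let F_bounds (a b : R) : a \in `[0, T] -> b \in `[0, T] -> a < b ->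
  F a <= fmu `[0, b] /\ fmu `[0, a] <= F b.
Proof.
move=> a01 b01 ab; have ba0 : 0 < b - a by rewrite subr_gt0.
apply: (@sandwich (fun r => Num.min 1 (Num.max 0 ((b - r) / (b - a))))) => //.
- have cl : continuous (fun r : R => (b - r) / (b - a)).
    move=> r; apply: cvgM; last exact: cvg_cst.
    by apply: cvgB; [exact: cvg_cst|exact: cvg_id].
  have cm : continuous (cst 0 \max (fun r : R => (b - r) / (b - a))).
    by move=> r; apply: continuous_max; [exact: cvg_cst|exact: cl].
  have ci : continuous (cst 1 \min (cst 0 \max (fun r : R => (b - r) / (b - a)))).
    by move=> r; apply: continuous_min; [exact: cvg_cst|exact: cm].
  exact: ci.
- by move=> r _; rewrite le_min ler01 le_max lexx ge_min lexx.
- move=> r _ ra; apply/min_idPl; rewrite le_max; apply/orP; right.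
  by rewrite ler_pdivlMr// mul1r lerD2l lerN2.
- move=> r _ br; rewrite (max_idPl _) ?(min_idPr _)//.
  by rewrite ler_pdivrMr// mul0r subr_le0 ltW.
Qed.

(** No time lies beyond [T], so the constant 1 is an admissible cut-off with [a = b = T] and both
    inequalities become one equality. *)
Let F_final : F T = fmu `[0, T].
Proof.
have T01 : T \in `[0, T] by rewrite in_itv/= lexx ltW.
have [||||h1 h2] := @sandwich (fun=> 1) T T T01 T01.
- by move=> r; exact: cvg_cst.
- by move=> r _; rewrite ler01 lexx.
- by [].
- by move=> r; rewrite in_itv/= => /andP[_ rT]; rewrite ltNge rT.
by apply/eqP; rewrite eq_le h1 h2.
Qed.

Lemma limit_energy_right (t : R) : 0 <= t -> t < T ->
  Ebar s @[s --> t^'+] --> E 0 x0 + powerI t - fmu `[0, t].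
Proof.
move=> t0 tT; have t01 : t \in `[0, T] by rewrite in_itv/= t0 ltW.
have cF : F s @[s --> t^'+] --> fmu `[0, t].
  apply/cvgrPdist_le => e e0.
  have Tt : 0 < T - t by rewrite subr_gt0.
  have [b /andP[tb bT] be] := measure_itv_right mu t0 Tt e0.
  rewrite subrKC in bT.
  near=> s.
  have ts : t < s by near: s; exact: nbhs_right_gt.
  have sb : s < b by near: s; exact: nbhs_right_lt.
  have s01 : s \in `[0, T].
    by rewrite in_itv/= (le_trans t0 (ltW ts)) (le_trans (ltW sb) bT).
  have b01 : b \in `[0, T] by rewrite in_itv/= bT (le_trans t0 (ltW tb)).
  have [_ h1] := F_bounds t01 s01 ts.
  have [h2 _] := F_bounds s01 b01 sb.
  rewrite ler_norml; apply/andP; split.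
    by rewrite lerBrDr addrC lerBlDr (le_trans h2).
  by rewrite lerBlDr (le_trans h1)// lerDr ltW.
have cI : powerI s @[s --> t^'+] --> powerI t.
  have /(continuous_within_itvP _ T_gt0)[c0 ci cT] := powerI_continuous.
  move: t0; rewrite le_eqVlt => /predU1P[<-//|t0].
  apply: cvg_at_right_filter; apply: c0; by rewrite in_itv/= t0 tT.
have : E 0 x0 + powerI s - F s @[s --> t^'+] --> E 0 x0 + powerI t - fmu `[0, t].
  by apply: cvgB => //; apply: cvgD => //; exact: cvg_cst.
apply: cvg_trans; apply: near_eq_cvg; near=> s; rewrite /F; ring.
Unshelve. all: by end_near. Qed.

Lemma limit_energy_left (t : R) : 0 < t -> t <= T ->
  Ebar s @[s --> t^'-] --> E 0 x0 + powerI t - fmu `[0, t[.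
Proof.
move=> t0 tT; have t01 : t \in `[0, T] by rewrite in_itv/= tT ltW.
have cF : F s @[s --> t^'-] --> fmu `[0, t[.
  apply/cvgrPdist_le => e e0.
  have [a /andP[a0 at_] ae] := measure_itv_left mu t0 e0.
  near=> s.
  have st : s < t by near: s; exact: nbhs_left_lt.
  have as_ : a < s by near: s; exact: nbhs_left_gt.
  have s01 : s \in `[0, T].
    by rewrite in_itv/= (le_trans a0 (ltW as_)) (le_trans (ltW st) tT).
  have a01 : a \in `[0, T] by rewrite in_itv/= a0 (le_trans (ltW at_)).
  (* A time strictly between [s] and [t]: [F s] is bounded by the mass of [[0, m]], which does not
     yet see an atom at [t]. *)
  pose m := (s + t) / 2.
  have sm : s < m by rewrite midf_lt.
  have mt : m < t by rewrite midf_lt.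
  have m01 : m \in `[0, T].
    by move: s01; rewrite !in_itv/= => /andP[s0 _]; rewrite (le_trans s0 (ltW sm)) (le_trans (ltW mt)).
  have [_ h1] := F_bounds a01 s01 as_.
  have [h2 _] := F_bounds s01 m01 sm.
  have h3 : fmu `[0, m] <= fmu `[0, t[.
    apply: fine_measure_le; [exact: measurable_itv|exact: measurable_itv|].
    by apply: subset_itvl; rewrite bnd_simp.
  rewrite ler_norml; apply/andP; split.
    by rewrite lerBrDr addrC lerBlDr (le_trans h2)// (le_trans h3)// lerDl ltW.
  by rewrite lerBlDr -lerBlDl (le_trans ae).
have cI : powerI s @[s --> t^'-] --> powerI t.
  have /(continuous_within_itvP _ T_gt0)[c0 ci cT] := powerI_continuous.
  move: tT; rewrite le_eqVlt => /predU1P[->//|tT].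
  by apply: cvg_at_left_filter; apply: c0; rewrite in_itv/= t0 tT.
have : E 0 x0 + powerI s - F s @[s --> t^'-] --> E 0 x0 + powerI t - fmu `[0, t[.
  by apply: cvgB => //; apply: cvgD => //; exact: cvg_cst.
apply: cvg_trans; apply: near_eq_cvg; near=> s; rewrite /F; ring.
Unshelve. all: by end_near. Qed.

Lemma limit_energy_start : Ebar 0 = E 0 x0.
Proof.
have T0 : 0 \in `[0, T] by rewrite in_itv/= lexx ltW.
have [_ _ /(_ 0 T0) c _] := hC.
have c0 : energy_along T E omega x0 (delta n) 0 @[n --> \oo] --> E 0 x0.
  apply: cvg_near_cst; apply: filterE => n.
  by rewrite /energy_along /evolution mul0r truncn0 minn0.
exact: cvg_unique c c0.
Qed.

Lemma limit_energy_end : Ebar T = E 0 x0 + powerI T - fmu `[0, T].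
Proof. by rewrite -F_final /F; ring. Qed.

End limit_balance.

(** * The limit evolution *)

Section time_interval.
Context {R : realType} (T : R).
Implicit Types (t s : timeI T).

Lemma nbhs_timeP t (B : set (timeI T)) :
  nbhs t B <-> exists2 e : R, 0 < e & forall s, `|set_val s - set_val t| < e -> B s.
Proof.
split=> [|[e e0 eB]].
  case=> _ [[W oW <-] /= Wt WB].
  have /nbhs_ballP[e /= e0 eW] : nbhs (set_val t : R) W by exact: open_nbhs_nbhs.
  by exists e => // s st; apply: WB; apply: eW; rewrite /ball/= distrC.
have ct : set_val s @[s --> t] --> (set_val t : R) by exact: initial_continuous.
have : \forall s \near t, ball (set_val t : R) e (set_val s).
  by apply: ct; exact: nbhsx_ballx.
by apply: filterS => s; rewrite /ball/= distrC => /eB.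
Qed.

Definition mktime (r : R) (rT : r \in `[0, T]) : timeI T := exist _ r (mem_set rT).

Lemma set_val_mktime (r : R) (rT : r \in `[0, T]) : set_val (mktime rT) = r.
Proof. by []. Qed.

Lemma time_itv t : 0 <= set_val t <= T.
Proof. by have := timeP t; rewrite in_itv. Qed.

Lemma within_time_proper t (A : set (timeI T)) :
  (forall e : R, 0 < e -> exists2 s, A s & `|set_val s - set_val t| < e) ->
  ProperFilter (within A (nbhs t)).
Proof.
move=> h; apply: within_nbhs_proper => B /nbhs_timeP[e e0 eB].
by have [s As st] := h e e0; exists s; split=> //; exact: eB.
Qed.

Lemma right_proper t : set_val t < T ->
  ProperFilter (within [set s | set_val t < set_val s] (nbhs t)).
Proof.
move=> tT; apply: within_time_proper => e e0.
have /andP[t0 _] := time_itv t.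
have [m m0 [me mT]] : exists2 m, 0 < m & m < e /\ set_val t + m <= T.
  exists (Num.min (e / 2) (T - set_val t)); first by rewrite lt_min divr_gt0//= subr_gt0.
  split; first by rewrite gt_min; apply/orP; left; rewrite ltr_pdivrMr// ltr_pMr// ltr1n.
  by rewrite -lerBrDl ge_min lexx orbT.
have tm : set_val t + m \in `[0, T] by rewrite in_itv/= mT addr_ge0// ltW.
exists (mktime tm); rewrite /= ?set_val_mktime ?ltrDl//.
by rewrite addrAC subrr add0r gtr0_norm.
Qed.

Lemma left_proper t : 0 < set_val t ->
  ProperFilter (within [set s | set_val s < set_val t] (nbhs t)).
Proof.
move=> t0; apply: within_time_proper => e e0.
have /andP[_ tT] := time_itv t.
have [m m0 [me mt]] : exists2 m, 0 < m & m < e /\ m <= set_val t.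
  exists (Num.min (e / 2) (set_val t)); first by rewrite lt_min divr_gt0//= t0.
  split; first by rewrite gt_min; apply/orP; left; rewrite ltr_pdivrMr// ltr_pMr// ltr1n.
  by rewrite ge_min lexx orbT.
have tm : set_val t - m \in `[0, T].
  by rewrite in_itv/= subr_ge0 mt/= (le_trans _ tT)// gerBl ltW.
exists (mktime tm); rewrite /= ?set_val_mktime ?gtrBl//.
by rewrite addrAC subrr add0r normrN gtr0_norm.
Qed.

Lemma time_cvg_right t :
  set_val s @[s --> within [set s | set_val t < set_val s] (nbhs t)] --> (set_val t)^'+.
Proof.
move=> P hP; have {}hP : \forall s \near (set_val t : R), set_val t < s -> P s by [].
have ct : set_val s @[s --> t] --> (set_val t : R) by exact: initial_continuous.
exact: ct _ hP.
Qed.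

Lemma time_cvg_left t :
  set_val s @[s --> within [set s | set_val s < set_val t] (nbhs t)] --> (set_val t)^'-.
Proof.
move=> P hP; have {}hP : \forall s \near (set_val t : R), s < set_val t -> P s by [].
have ct : set_val s @[s --> t] --> (set_val t : R) by exact: initial_continuous.
exact: ct _ hP.
Qed.

Context {Z : topologicalType}.
Hypothesis hZ : hausdorff_space Z.
Implicit Types (f : timeI T -> Z) (z : Z).

Lemma right_limitE f t z : set_val t < T -> tends_right f t z -> right_limit f t = z.
Proof.
move=> tT fz; rewrite /right_limit tT; have PF := right_proper tT.
case: xgetP => [w -> fw|/(_ z)//].
exact: (@cvg_unique _ hZ (f @ within [set s | set_val t < set_val s] (nbhs t)) _ _ z fw fz).
Qed.

Lemma left_limitE f t z : 0 < set_val t -> tends_left f t z -> left_limit f t = z.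
Proof.
move=> t0 fz; rewrite /left_limit t0; have PF := left_proper t0.
case: xgetP => [w -> fw|/(_ z)//].
exact: (@cvg_unique _ hZ (f @ within [set s | set_val s < set_val t] (nbhs t)) _ _ z fw fz).
Qed.

Lemma right_limit_end f t : set_val t = T -> right_limit f t = f t.
Proof. by rewrite /right_limit => ->; rewrite ltxx. Qed.

Lemma left_limit_start f t : set_val t = 0 -> left_limit f t = f t.
Proof. by rewrite /left_limit => ->; rewrite ltxx. Qed.

Lemma continuous_not_jump f t : {for t, continuous f} -> ~ jump_set f t.
Proof.
move=> cf; apply => /=; have /andP[] := time_itv t.
have fr : tends_right f t (f t) by apply: cvg_trans cf; apply: cvg_app; exact: cvg_within.
have fl : tends_left f t (f t) by apply: cvg_trans cf; apply: cvg_app; exact: cvg_within.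
rewrite !le_eqVlt => /predU1P[/esym t0|t0] /predU1P[tT|tT].
- by rewrite left_limit_start// right_limit_end.
- by rewrite (right_limitE tT fr) left_limit_start.
- by rewrite (left_limitE t0 fl) right_limit_end.
- by rewrite (right_limitE tT fr) (left_limitE t0 fl).
Qed.

End time_interval.

(** * The pointwise limit along the ultrafilter and its regularity *)

Section limit_evolution.
Context {R : realType} {X : metricType R} (T : R) (E : R -> X -> R).
Hypotheses (T_gt0 : 0 < T) (hA2 : energy_regular T E) (hA3 : power_control T E).
Hypotheses (hA4 : compact_sublevels T E) (hA5 : critical_sets_split T E).
Variables (delta : nat -> R) (omega : R -> X -> X) (x0 : X).
Hypotheses (hdelta : vanishing_steps delta) (hx0 : slope (E 0) x0 = 0%E).
Variables (mu : {finite_measure set (measurableTypeR R) -> \bar R}).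
Variables (Ebar D : R -> R).
Hypothesis hC : qs_convergence T E omega x0 delta mu Ebar D.
Hypotheses (hAx1 : energy_decreasing_rule T E omega).
Hypotheses (hAx2 : critical_rule T E omega).
Hypothesis hAx3 : dissipative_jumps_rule T E omega x0.

Let ev (n : nat) (t : R) : X := evolution T omega x0 (delta n) t.

Let delta_gt0 n : 0 < delta n. Proof. by have [] := hdelta. Qed.

Variables (U : set_system nat) (y : R -> X) (K : set X).
Hypotheses (UU : UltraFilter U) (leU : \oo `<=` U).
Hypotheses (cK : compact K) (Kev : forall n t, K (ev n t)).
Hypothesis Ky : forall t, K (y t).
Hypothesis evy : forall t, ev n t @[n --> U] --> y t.

Lemma limit_crit (t : R) : t \in `[0, T] -> crit E t (y t).
Proof.
move=> t01; have [_ _ d0] := hdelta.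
apply: (evolution_limit_crit T_gt0 hx0 hAx2 hA2 (F := U) _ delta_gt0 _ (s := fun=> t)).
- by move=> P /d0; exact: leU.
- exact: filterE.
- exact: cvg_cst.
- by [].
- exact: evy.
Qed.

Lemma limit_energy (t : R) : t \in `[0, T] -> Ebar t = E t (y t).
Proof.
move=> t01; have [_ _ /(_ t t01) cE _] := hC.
have c1 : energy_along T E omega x0 (delta n) t @[n --> U] --> Ebar t.
  by move=> P /cE; exact: leU.
have c2 : energy_along T E omega x0 (delta n) t @[n --> U] --> E t (y t).
  apply: (@energy_cvg _ _ _ _ hA2 _ U _ (fun=> t) (fun n => ev n t) t (y t) t01).
  - exact: filterE.
  - exact: cvg_cst.
  - exact: evy.
exact: cvg_unique c1 c2.
Qed.

Lemma limit_shadows (e t s : R) (x : X) : s \in `[0, T] -> `|s - t| < e ->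
  mdist x (y s) < e -> \forall n \near U, shadows T delta omega x0 e t x n s.
Proof.
move=> s01 st xs; have e0 : 0 < e - mdist x (y s) by rewrite subr_gt0.
have /metricType_numDomainType.cvgrPdist_lt/(_ _ e0) := evy (t := s).
apply: filterS => n h; split=> //.
by apply: le_lt_trans (metric_triangle _ (y s) _) _; rewrite -ltrBrDl.
Qed.

(** Transfers the alternative from the discrete evolutions to [y]: for two given times, one index as
    large as desired approximates [y] at both, since [U] is finer than the filter of large
    indices. *)
Lemma limit_jump_alternative (t : R) (x1 x2 : X) : t \in `[0, T] ->
  (forall e, 0 < e -> exists s1 s2,
    [/\ s1 \in `[0, T], s2 \in `[0, T] & s1 <= s2] /\
    [/\ `|s1 - t| < e, `|s2 - t| < e, mdist x1 (y s1) < e & mdist x2 (y s2) < e]) ->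
  path_joined (R := R) (crit E t) x1 x2 \/
  exists c : R, [/\ 0 < c, (c%:E <= mu [set t])%E & c <= E t x1 - E t x2].
Proof.
move=> t01 h; apply: (jump_alternative T_gt0 hA2 hdelta hx0 hC hAx2 hAx3 t01).
move=> e N e0; have [s1 [s2 [[s1I s2I s12] [s1t s2t x1s x2s]]]] := h e e0.
have NU : \forall n \near U, (N <= n)%N by apply: leU; exists N.
have [n [Nn [sh1 sh2]]] := @filter_ex _ U _ _
  (filterI NU (filterI (limit_shadows s1I s1t x1s) (limit_shadows s2I s2t x2s))).
by exists n, s1, s2.
Qed.

Let etahat (t : timeI T) : qspace T E := qmap E t (y (set_val t)).

Let I01 (s : timeI T) : set_val s \in `[0, T]. Proof. exact: timeP. Qed.

Lemma qmap_joined (t : timeI T) (x x' : X) :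
  path_joined (R := R) (crit E (set_val t)) x x' -> qmap E t x = qmap E t x'.
Proof. by move=> j; apply/qmapP/asboolP; right. Qed.

Lemma qmap_cvg (I : Type) (F : set_system I) (FF : Filter F) (tt : I -> timeI T)
    (xx : I -> X) (t : timeI T) (x : X) :
  tt i @[i --> F] --> t -> xx i @[i --> F] --> x ->
  qmap E (tt i) (xx i) @[i --> F] --> qmap E t x.
Proof.
move=> ct cx; have cp : (tt i, xx i) @[i --> F] --> (t, x) by exact: cvg_pair ct cx.
exact: (cvg_comp _ _ cp (@qmap_continuous _ _ T E (t, x))).
Qed.

Lemma near_limit (G : set_system (timeI T)) (t : timeI T) (x : X) (e : R) :
  UltraFilter G -> nbhs t `<=` G -> y (set_val s) @[s --> G] --> x -> 0 < e ->
  \forall s \near G, `|set_val s - set_val t| < e /\ mdist x (y (set_val s)) < e.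
Proof.
move=> FG Gt /metricType_numDomainType.cvgrPdist_lt yx e0.
have Ge : \forall s \near G, `|set_val s - set_val t| < e.
  by apply: Gt; apply/nbhs_timeP; exists e.
by apply: filterS2 Ge (yx e e0).
Qed.

(** The condition on sides treats left and right limits together: relative to any fixed time of [A],
    almost all times for [F] lie on one given side. Hence times for two ultrafilters finer than [F]
    can be picked in any prescribed order. *)
Lemma one_sided_limit (F : set_system (timeI T)) (A : set (timeI T)) (t : timeI T) :
  ProperFilter F -> nbhs t `<=` F -> F A ->
  (forall s, A s -> \forall r \near F, set_val r <= set_val s) \/
  (forall s, A s -> \forall r \near F, set_val s <= set_val r) ->
  exists z : qspace T E, etahat s @[s --> F] --> z.
Proof.
move=> PF tF FA side; pose ys (s : timeI T) := y (set_val s).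
have joined (G1 G2 : set_system (timeI T)) (x1 x2 : X) :
    UltraFilter G1 -> UltraFilter G2 -> F `<=` G1 -> F `<=` G2 ->
    ys s @[s --> G1] --> x1 -> ys s @[s --> G2] --> x2 ->
    path_joined (R := R) (crit E (set_val t)) x1 x2 \/
    E (set_val t) x2 < E (set_val t) x1.
  move=> UG1 UG2 FG1 FG2 y1 y2.
  have n1 e := @near_limit G1 t x1 e UG1 (subset_trans tF FG1) y1.
  have n2 e := @near_limit G2 t x2 e UG2 (subset_trans tF FG2) y2.
  have [||[c [c0 _ cE]]] := @limit_jump_alternative (set_val t) x1 x2 (I01 t).
  (* The time farther from [t] is picked before the nearer one: [s2] if the times approach from the
     right, [s1] if from the left. *)
  - move=> e e0; case: side => [le|ge].
    + have [s2 [As2 [s2t x2s]]] := @filter_ex _ G2 _ _ (filterI (FG2 _ FA) (n2 e e0)).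
      have [s1 [s12 [s1t x1s]]] := @filter_ex _ G1 _ _ (filterI (FG1 _ (le _ As2)) (n1 e e0)).
      by exists (set_val s1), (set_val s2).
    + have [s1 [As1 [s1t x1s]]] := @filter_ex _ G1 _ _ (filterI (FG1 _ FA) (n1 e e0)).
      have [s2 [s12 [s2t x2s]]] := @filter_ex _ G2 _ _ (filterI (FG2 _ (ge _ As1)) (n2 e e0)).
      by exists (set_val s1), (set_val s2).
  - by left.
  - by right; rewrite -subr_gt0 (lt_le_trans c0).
have [G [UG FG]] := ultraFilterLemma PF.
have [x _ yx] := ultra_cvg_compact UG cK (f := ys) (filterE _ (fun s => Ky (set_val s))).
exists (qmap E t x); apply: contrapT => nz.
have [G' [UG' FG'] [W [oW Wz] nW]] := ultra_not_cvg PF nz.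
have [x' _ yx'] := ultra_cvg_compact UG' cK (f := ys) (filterE _ (fun s => Ky (set_val s))).
have jxx' : path_joined (R := R) (crit E (set_val t)) x x'.
  have [//|lt1] := joined G G' x x' UG UG' FG FG' yx yx'.
  have [|lt2] := joined G' G x' x UG' UG FG' FG yx' yx; first exact: path_joined_sym.
  by move: (lt_trans lt1 lt2); rewrite ltxx.
have cG' : etahat s @[s --> G'] --> qmap E t x'.
  by apply: qmap_cvg => //; exact: subset_trans tF FG'.
have WG' : \forall s \near G', W (etahat s).
  by apply: cG'; rewrite -(qmap_joined jxx'); exact: open_nbhs_nbhs.
by have [s [ns]] := @filter_ex _ G' _ _ (filterI nW WG').
Qed.

Lemma limit_continuous (t : timeI T) : ~ atoms T mu t -> {for t, continuous etahat}.
Proof.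
move=> /contrapT mut0; apply: contrapT => nc.
have [G [UG tG] [W [oW Wz] nW]] := ultra_not_cvg (nbhs_pfilter t) nc.
pose ys (s : timeI T) := y (set_val s).
have [x _ yx] := ultra_cvg_compact UG cK (f := ys) (filterE _ (fun s => Ky (set_val s))).
have n1 e := @near_limit G t x e UG tG yx.
have jx : path_joined (R := R) (crit E (set_val t)) (y (set_val t)) x.
  (* The ultrafilter decides on which side of [t] its times lie. The time [t] itself, with value
     [y t], then serves as the other time in Axiom 3, and a zero mass at [t] excludes a drop. *)
  have [Gle|Gnle] := in_ultra_setVsetC [set s : timeI T | set_val s <= set_val t] UG.
  - apply: path_joined_sym.
    have [||[c [c0 mc _]]] := @limit_jump_alternative (set_val t) x (y (set_val t)) (I01 t).
    + move=> e e0; have [s [st [s1 s2]]] := @filter_ex _ G _ _ (filterI Gle (n1 e e0)).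
      by exists (set_val s), (set_val t); rewrite subrr normr0 mdistxx.
    + by [].
    + by move: mc; rewrite mut0 lee_fin leNgt c0.
  - have [||[c [c0 mc _]]] := @limit_jump_alternative (set_val t) (y (set_val t)) x (I01 t).
    + move=> e e0; have [s [/negP st [s1 s2]]] := @filter_ex _ G _ _ (filterI Gnle (n1 e e0)).
      exists (set_val t), (set_val s); rewrite subrr normr0 mdistxx; split=> //.
      by split=> //; rewrite ltW// ltNge.
    + by [].
    + by move: mc; rewrite mut0 lee_fin leNgt c0.
have cG : etahat s @[s --> G] --> qmap E t x by exact: qmap_cvg.
have WG : \forall s \near G, W (etahat s).
  by apply: cG; rewrite -(qmap_joined jx); exact: open_nbhs_nbhs.
by have [s [ns]] := @filter_ex _ G _ _ (filterI nW WG).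
Qed.

(** At stage [m] closeness is demanded only at the times with code at most [m]. These are finitely
    many conditions, so they hold together along [U]. *)
Lemma countable_subseq (B : set R) : countable B ->
  exists2 k : nat -> nat, {homo k : m n / (m < n)%N} &
    forall r, B r -> ev (k n) r @[n --> \oo] --> y r.
Proof.
move=> /countable_injP[g ginj].
have [k hk kP] : exists2 k : nat -> nat, {homo k : m n / (m < n)%N} &
    forall m (i : 'I_m.+1) r, B r -> g r = i -> mdist (y r) (ev (k m) r) < m.+1%:R^-1.
  apply: (@increasing_choice (fun m n => forall (i : 'I_m.+1) r, B r -> g r = i ->
    mdist (y r) (ev n r) < m.+1%:R^-1)) => m N.
  have NU : \forall n \near U, (N <= n)%N by apply: leU; exists N.
  have : \forall n \near U, forall i : 'I_m.+1, forall r, B r -> g r = i ->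
      mdist (y r) (ev n r) < m.+1%:R^-1.
    apply: filter_forall => i.
    have [[r Br gr]|nr] := pselect (exists2 r, B r & g r = i); last first.
      by apply: filterE => n r Br gr; case: nr; exists r.
    have m0 : (0 : R) < m.+1%:R^-1 by rewrite invr_gt0.
    have /metricType_numDomainType.cvgrPdist_lt/(_ _ m0) := evy (t := r).
    apply: filterS => n h r' Br' gr'.
    by have -> : r' = r by apply: ginj; rewrite ?inE// gr.
  by move=> /(filterI NU) /filter_ex[n [Nn h]]; exists n.
exists k => // r Br; apply/metricType_numDomainType.cvgrPdist_lt => e e0.
near=> n.
have gn : (g r < n.+1)%N by rewrite ltnS; near: n; exists (g r).
apply: lt_trans (kP n (Ordinal gn) r Br erefl) _.
by near: n; exact: near_infty_natSinv_lt (PosNum e0).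
Unshelve. all: by end_near. Qed.

Lemma rational_times_proper (t : timeI T) (B : set R) :
  (forall q : rat, B (ratr q)) ->
  ProperFilter (within [set s : timeI T | B (set_val s)] (nbhs t)).
Proof.
move=> BQ; apply: within_time_proper => e e0; have /andP[t0 tT] := time_itv t.
have [|q] := @rat_in_itvoo R (Num.max 0 (set_val t - e)) (Num.min T (set_val t + e)).
  rewrite lt_min !gt_max T_gt0 ltr_pwDr//= (lt_le_trans _ tT) ?gtrBl//=.
  by rewrite ltrBlDr -addrA ltrDl addr_gt0.
rewrite in_itv/= lt_min gt_max => /andP[/andP[q0 qt] /andP[qT tq]].
have qI : ratr q \in `[0, T] by rewrite in_itv/= !ltW.
exists (mktime qI); first by rewrite /= set_val_mktime.
by rewrite set_val_mktime ltr_distl qt.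
Qed.

(* The subsequence converges pointwise on a countable dense set of times that
   contains the atoms; elsewhere the limit is forced by continuity. *)
Lemma limit_subsequence :
  exists2 k : nat -> nat, {homo k : m n / (m < n)%N} &
    forall t : timeI T, qmap E t (ev (k n) (set_val t)) @[n --> \oo] --> etahat t.
Proof.
pose B := [set r : R | mu [set r] <> 0%E] `|` range (ratr : rat -> R).
have cB : countable B.
  rewrite /B -bigcup2E; apply: bigcup_countable => // -[|[|i]] _ /=.
  - exact: measure_atoms_countable.
  - by apply: sub_countable (countableP [set: rat]); exact: card_image_le.
  - exact: countable0.
have [k hk kB] := countable_subseq cB.
exists k => // t; have [Bt|nBt] := pselect (B (set_val t)).
  by apply: qmap_cvg; [exact: cvg_cst|exact: kB].
have nat_t : ~ atoms T mu t by move=> mut; apply: nBt; left.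
apply: contrapT => nc.
have [G [UG leG] [W [oW Wz] nW]] := ultra_not_cvg eventually_filter nc.
have [x1 _ yx1] := ultra_cvg_compact UG cK (f := fun n => ev (k n) (set_val t))
  (filterE _ (fun n => Kev (k n) (set_val t))).
have PF : ProperFilter (within [set s : timeI T | B (set_val s)] (nbhs t)).
  by apply: rational_times_proper => q; right; exists q.
have [H [UH leH]] := ultraFilterLemma PF.
have tH : nbhs t `<=` H by move=> P tP; apply: leH; apply: filterS tP => s.
have HB : \forall s \near H, B (set_val s) by apply: leH; exact: withinT.
pose ys (s : timeI T) := y (set_val s).
have [x2 _ yx2] := ultra_cvg_compact UH cK (f := ys) (filterE _ (fun s => Ky (set_val s))).
(* Times of [B] accumulate at [t], and [etahat] is continuous there, so a limit of [y] along them
   represents [etahat t]. *)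
have etaE : etahat t = qmap E t x2.
  have c1 : etahat s @[s --> H] --> etahat t.
    by move=> P /(limit_continuous nat_t); exact: tH.
  have c2 : etahat s @[s --> H] --> qmap E t x2 by exact: qmap_cvg.
  exact: (cvg_unique (qspace_hausdorff hA2 hA3 hA4 hA5) c1 c2).
have n2 e := @near_limit H t x2 e UH tH yx2.
have jx : path_joined (R := R) (crit E (set_val t)) x1 x2.
  (* At [s] in [B] the extracted sequence converges to [y s], hence also along [G]; one index
     therefore serves both for [x1] at [t] and for [x2] at [s]. *)
  have close e N (s : timeI T) : 0 < e -> B (set_val s) ->
      `|set_val s - set_val t| < e -> mdist x2 (y (set_val s)) < e ->
      exists n, [/\ (N <= n)%N, shadows T delta omega x0 e (set_val t) x1 n (set_val t) &
        shadows T delta omega x0 e (set_val t) x2 n (set_val s)].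
    move=> e0 Bs st x2s.
    have d0 : 0 < e - mdist x2 (y (set_val s)) by rewrite subr_gt0.
    have /metricType_numDomainType.cvgrPdist_lt/(_ _ d0)/leG s2 := kB _ Bs.
    have /metricType_numDomainType.cvgrPdist_lt/(_ _ e0) s1 := yx1.
    have NG : \forall n \near G, (N <= n)%N by apply: leG; exists N.
    have [n [Nn [h1 h2]]] := @filter_ex _ G _ _ (filterI NG (filterI s1 s2)).
    exists (k n); split; first exact: leq_trans Nn (increasing_seq_ge hk n).
      by split=> //; rewrite subrr normr0.
    split=> //.
    by apply: le_lt_trans (metric_triangle _ (y (set_val s)) _) _; rewrite -ltrBrDl.
  have [Hle|Hnle] := in_ultra_setVsetC [set s : timeI T | set_val s <= set_val t] UH.
  - apply: path_joined_sym.
    have [||[c [c0 mc _]]] := jump_alternative T_gt0 hA2 hdelta hx0 hC hAx2 hAx3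
      (t := set_val t) (x1 := x2) (x2 := x1) (I01 t).
    + move=> e N e0.
      have [s [st [Bs [s1 s2]]]] := @filter_ex _ H _ _ (filterI Hle (filterI HB (n2 e e0))).
      have [n [Nn sh1 sh2]] := close e N s e0 Bs s1 s2.
      by exists n, (set_val s), (set_val t).
    + by [].
    + by move: mc; move/contrapT: nat_t => ->; rewrite lee_fin leNgt c0.
  - have [||[c [c0 mc _]]] := jump_alternative T_gt0 hA2 hdelta hx0 hC hAx2 hAx3
      (t := set_val t) (x1 := x1) (x2 := x2) (I01 t).
    + move=> e N e0.
      have [s [/negP st [Bs [s1 s2]]]] :=
        @filter_ex _ H _ _ (filterI Hnle (filterI HB (n2 e e0))).
      have [n [Nn sh1 sh2]] := close e N s e0 Bs s1 s2.
      by exists n, (set_val t), (set_val s); split=> //; rewrite ltW// ltNge.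
    + by [].
    + by move: mc; move/contrapT: nat_t => ->; rewrite lee_fin leNgt c0.
have cG : qmap E t (ev (k n) (set_val t)) @[n --> G] --> etahat t.
  by rewrite etaE -(qmap_joined jx); apply: qmap_cvg; [exact: cvg_cst|exact: yx1].
have WG : \forall n \near G, W (qmap E t (ev (k n) (set_val t))).
  by apply: cG; exact: open_nbhs_nbhs.
by have [n [nn]] := @filter_ex _ G _ _ (filterI nW WG).
Qed.

Lemma right_limit_exists (t : timeI T) : set_val t < T ->
  exists z : qspace T E, tends_right etahat t z.
Proof.
move=> tT; have PF := right_proper tT.
apply: (@one_sided_limit _ [set s | set_val t < set_val s] t PF).
- by move=> P tP; apply: filterS tP => s.
- exact: withinT.
- left=> s /= ts; have : \forall r \near t, `|set_val r - set_val t| < set_val s - set_val t.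
    by apply/nbhs_timeP; exists (set_val s - set_val t) => //; rewrite subr_gt0.
  by apply: filterS => r rs _; have := ltr_normlW rs; rewrite ltrD2r => /ltW.
Qed.

Lemma left_limit_exists (t : timeI T) : 0 < set_val t ->
  exists z : qspace T E, tends_left etahat t z.
Proof.
move=> t0; have PF := left_proper t0.
apply: (@one_sided_limit _ [set s | set_val s < set_val t] t PF).
- by move=> P tP; apply: filterS tP => s.
- exact: withinT.
- right=> s /= st; have : \forall r \near t, `|set_val r - set_val t| < set_val t - set_val s.
    by apply/nbhs_timeP; exists (set_val t - set_val s) => //; rewrite subr_gt0.
  apply: filterS => r; rewrite distrC => rs _; have := ltr_normlW rs.
  by rewrite ltrD2l ltrN2 => /ltW.
Qed.

(** * Energy of the one-sided limits, balance and jumps *)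

Let powerI (t : R) := \int[@lebesgue_measure R]_(r in `[0, t]) D r.

Lemma qenergy_limit (t : timeI T) : qenergy (etahat t) = Ebar (set_val t).
Proof. by rewrite qenergy_qmap// limit_energy. Qed.

Lemma qenergy_right_limit (t : timeI T) :
  qenergy (right_limit etahat t) =
  E 0 x0 + powerI (set_val t) - fine (mu `[0, set_val t]%classic).
Proof.
have /andP[t0] := time_itv t; rewrite le_eqVlt => /predU1P[tT|tT].
  rewrite right_limit_end// qenergy_limit tT.
  exact: (limit_energy_end T_gt0 hA2 delta_gt0 hC hAx1).
have [z etaz] := right_limit_exists tT.
rewrite (right_limitE (qspace_hausdorff hA2 hA3 hA4 hA5) tT etaz).
have PF := right_proper tT.
pose F : set_system (timeI T) := within [set s | set_val t < set_val s] (nbhs t).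
have c1 : Ebar (set_val s) @[s --> F] --> qenergy z.
  have : qenergy (etahat s) @[s --> F] --> qenergy z.
    exact: (cvg_comp _ _ etaz (@qenergy_continuous _ _ _ _ hA2 hA5 z)).
  by apply: cvg_trans; apply: near_eq_cvg; apply: filterE => s; rewrite qenergy_limit.
have c2 := cvg_comp _ _ (@time_cvg_right _ _ t)
  (limit_energy_right T_gt0 hA2 delta_gt0 hC hAx1 t0 tT).
exact: (@cvg_unique _ (@Rhausdorff R) (Ebar (set_val s) @[s --> F]) _ _ _ c1 c2).
Qed.

Lemma qenergy_left_limit (t : timeI T) :
  qenergy (left_limit etahat t) =
  E 0 x0 + powerI (set_val t) - fine (mu `[0, set_val t[%classic).
Proof.
have /andP[+ tT] := time_itv t; rewrite le_eqVlt => /predU1P[/esym t0|t0].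
  rewrite left_limit_start// qenergy_limit t0 (limit_energy_start T_gt0 hC).
  rewrite /powerI set_itv1 Rintegral_set1 set_itv_ge ?measure0/= ?subr0 ?addr0//.
  by rewrite bnd_simp ltxx.
have [z etaz] := left_limit_exists t0.
rewrite (left_limitE (qspace_hausdorff hA2 hA3 hA4 hA5) t0 etaz).
have PF := left_proper t0.
pose F : set_system (timeI T) := within [set s | set_val s < set_val t] (nbhs t).
have c1 : Ebar (set_val s) @[s --> F] --> qenergy z.
  have : qenergy (etahat s) @[s --> F] --> qenergy z.
    exact: (cvg_comp _ _ etaz (@qenergy_continuous _ _ _ _ hA2 hA5 z)).
  by apply: cvg_trans; apply: near_eq_cvg; apply: filterE => s; rewrite qenergy_limit.
have c2 := cvg_comp _ _ (@time_cvg_left _ _ t)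
  (limit_energy_left T_gt0 hA2 delta_gt0 hC hAx1 t0 tT).
exact: (@cvg_unique _ (@Rhausdorff R) (Ebar (set_val s) @[s --> F]) _ _ _ c1 c2).
Qed.

(** The right limit at [t] accounts for the mass of [[0, t]], the left limit at [s] only for that of
    [[0, s[]. The difference is the closed interval, with the atoms at both ends. *)
Lemma limit_balance (s t : timeI T) : set_val s <= set_val t ->
  qenergy (right_limit etahat t) - qenergy (left_limit etahat s) =
  \int[@lebesgue_measure R]_(r in `[set_val s, set_val t]) D r
    - fine (mu `[set_val s, set_val t]%classic).
Proof.
move=> st; rewrite qenergy_right_limit qenergy_left_limit.
have /andP[s0 _] := time_itv s; have /andP[_ tT] := time_itv t.
have iD : (@lebesgue_measure R).-integrable `[0, set_val t] (EFin \o D).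
  apply: integrableS (limit_power_integrable T_gt0 hC) => //.
  by apply: subset_itvl; rewrite bnd_simp.
have -> : \int[@lebesgue_measure R]_(r in `[set_val s, set_val t]) D r =
    powerI (set_val t) - powerI (set_val s).
  rewrite /powerI Rintegral_itvB ?bnd_simp//.
  rewrite Rintegral_itv_obnd_cbnd//; apply: integrableS iD => //.
  by apply: subset_itv; rewrite bnd_simp.
have -> : fine (mu `[0, set_val t]%classic) =
    fine (mu `[0, set_val s[%classic) + fine (mu `[set_val s, set_val t]%classic).
  rewrite -fineD ?fin_num_measure// -measureU//; first congr (fine (mu _)).
  - by apply: itv_bndbnd_setU; rewrite bnd_simp.
  - apply/seteqP; split=> // r [] /=; rewrite !in_itv/= => /andP[_ rs] /andP[sr _].
    by move: rs; rewrite ltNge sr.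
by ring.
Qed.

Lemma limit_jump (t : timeI T) :
  qenergy (left_limit etahat t) - qenergy (right_limit etahat t) =
  fine (mu [set set_val t]).
Proof.
rewrite -opprB limit_balance// set_itv1 Rintegral_set1.
by rewrite sub0r opprK.
Qed.

(** Equal one-sided limits have equal energies, which excludes mass at [t]; conversely, [etahat] is
    continuous wherever [mu] has no atom. *)
Lemma atoms_jump_set : atoms T mu = jump_set etahat.
Proof.
apply/seteqP; split=> [t mut lr|t jt]; last first.
  apply: contrapT => /limit_continuous ct.
  exact: (continuous_not_jump (qspace_hausdorff hA2 hA3 hA4 hA5) ct jt).
have := limit_jump t; rewrite lr subrr => /esym mu0; apply: mut.
by rewrite -[LHS]fineK ?fin_num_measure// mu0.
Qed.

Lemma atoms_countable : countable (atoms T mu).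
Proof.
have /countable_injP[g ginj] := measure_atoms_countable mu.
apply/countable_injP; exists (g \o set_val) => s t /set_mem ms /set_mem mt /= gst.
by apply: val_inj; apply: ginj; rewrite ?inE.
Qed.

Lemma qclass_limit (t : timeI T) : qclass (etahat t) `<=`
  [set p | p.1 = t /\ slope (E (set_val t)) p.2 = 0%E].
Proof.
move=> [s x] /= /qmapP/asboolP[[-> ->]|/= [<- jx]]; split=> //.
  exact: limit_crit.
by have [] := path_joined_crit jx.
Qed.

End limit_evolution.

Theorem theorem3p9 (R : realType) (T : R) (X : metricType R) (E : R -> X -> R)
  (T_gt0 : 0 < T)
  (hA1 : locally_compact [set: X])
  (hA2 : energy_regular T E)
  (hA3 : power_control T E)
  (hA4 : compact_sublevels T E)
  (hA5 : critical_sets_split T E)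
  (delta : nat -> R) (hdelta : vanishing_steps delta)
  (omega : R -> X -> X)
  (x0 : X) (hx0 : slope (E 0) x0 = 0%E)
  (mu : {finite_measure set (measurableTypeR R) -> \bar R})
  (Ebar D : R -> R)
  (hC : qs_convergence T E omega x0 delta mu Ebar D)
  (hAx1 : energy_decreasing_rule T E omega)
  (hAx2 : critical_rule T E omega)
  (hAx3 : dissipative_jumps_rule T E omega x0) :
  exists etahat : timeI T -> qspace T E,
  [/\
    (* (i) *)
    (forall t, set_val t < T -> exists y, tends_right etahat t y) /\
    (forall t, 0 < set_val t -> exists y, tends_left etahat t y),
    (* (ii) *)
    forall t, qclass (etahat t)
                `<=` [set p | p.1 = t /\ slope (E (set_val t)) p.2 = 0%E],
    (* (iii) *)
    (forall s t : timeI T, set_val s <= set_val t ->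
       qenergy (right_limit etahat t) - qenergy (left_limit etahat s) =
       \int[@lebesgue_measure R]_(r in `[set_val s, set_val t]) D r
         - fine (mu `[set_val s, set_val t]%classic)) /\
    countable (atoms T mu),
    (* (iv) *)
    [/\ forall t, ~ atoms T mu t -> {for t, continuous etahat},
        atoms T mu = jump_set etahat &
        forall t, qenergy (left_limit etahat t) - qenergy (right_limit etahat t)
                  = fine (mu [set set_val t])] &
    (* (v) *)
    exists2 k : nat -> nat, {homo k : m n / (m < n)%N} &
      forall t : timeI T,
        qmap E t (evolution T omega x0 (delta (k n)) (set_val t)) @[n --> \oo]
          --> etahat t].
Proof.
have [d_gt0 _ _] := hdelta.
have [K cK evK] := evolution_compact T_gt0 x0 hA2 hA3 hA4 hAx1.
have Kev n t : K (evolution T omega x0 (delta n) t) by exact: evK.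
have [U [UU leU]] := ultraFilterLemma eventually_filter.
(* The compact set contains the evolutions at every real argument, so a limit can be chosen without
   any condition on [t]. *)
have limU t : exists x,
    K x /\ evolution T omega x0 (delta n) t @[n --> U] --> x.
  by have [x Kx ex] := ultra_cvg_compact UU cK (filterE _ (Kev ^~ t)); exists x.
have [y yP] := choice limU.
have Ky t := (yP t).1; have evy t := (yP t).2.
exists (fun t => qmap E t (y (set_val t))); split.
- split=> t.
  + exact: (right_limit_exists T_gt0 hA2 hdelta hx0 hC hAx2 hAx3 UU leU cK Ky evy).
  + exact: (left_limit_exists T_gt0 hA2 hdelta hx0 hC hAx2 hAx3 UU leU cK Ky evy).
- exact: (qclass_limit T_gt0 hA2 hdelta hx0 hAx2 UU leU evy).
- split; last exact: atoms_countable.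
  exact: (limit_balance T_gt0 hA2 hA3 hA4 hA5 hdelta hx0 hC hAx1 hAx2 hAx3 UU leU cK Ky evy).
- split.
  + exact: (limit_continuous T_gt0 hA2 hdelta hx0 hC hAx2 hAx3 UU leU cK Ky evy).
  + exact: (atoms_jump_set T_gt0 hA2 hA3 hA4 hA5 hdelta hx0 hC hAx1 hAx2 hAx3 UU leU cK Ky evy).
  + exact: (limit_jump T_gt0 hA2 hA3 hA4 hA5 hdelta hx0 hC hAx1 hAx2 hAx3 UU leU cK Ky evy).
- exact: (limit_subsequence T_gt0 hA2 hA3 hA4 hA5 hdelta hx0 hC hAx2 hAx3 UU leU cK Kev Ky evy).
Qed.
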